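(* Let $W$ be of type $I_2(m)$ with $m\ge2$. For every positive integer $t$ the $q$-Kreweras numbers $\mathrm{Krew}(W,\chi,t;q)$ and the graded multiplicities $\langle Q_\chi,V\rangle$ of the reflection representation are as follows, where $[k]=(q^k-1)/(q-1)$. If $m$ is even: - $\phi_{1,0}$: $\mathrm{Krew}=q^{2t-2}$, $\langle Q,V\rangle=0$; - $\phi_{1,m/2}'$ and $\phi_{1,m/2}''$: $\mathrm{Krew}=q^{t-m+1}[t-1]/[2]$, $\langle Q,V\rangle=q$; - $\phi_{1,m}$: $\mathrm{Krew}=[t-1][t-m+1]/([2][m])$, $\langle Q,V\rangle=q^{m-1}+q$; - $\phi_{2,r}$ for $1\le r\le m/2-1$: $\mathrm{Krew}=q^{t-2r-1}(q^{t-1}-1)$, $\langle Q,V\rangle=q$. If $m$ is odd: - $\phi_{1,0}$: $\mathrm{Krew}=q^{2t-2}$, $\langle Q,V\rangle=0$; - $\phi_{1,m}$: $\mathrm{Krew}=[t-1][t-m+1]/([2][m])$, $\langle Q,V\rangle=q^{m-1}+q$; - $\phi_{2,r}$ for $1\le r\le(m-3)/2$: $\mathrm{Krew}=q^{t-2r-1}(q^{t-1}-1)$, $\langle Q,V\rangle=q$; - $\phi_{2,(m-1)/2}$: $\mathrm{Krew}=q^{t-m+1}[t-1]$, $\langle Q,V\rangle=q$.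
   Context: $W$ is the dihedral group of order $2m$ as a Coxeter group of type $I_2(m)$, $V$ its (complexified) 2-dimensional reflection representation, $\mathrm{sgn}=\wedge^2V$; it has $m$ reflections. The fake degree $b(\chi)$ of $\chi\in\mathrm{Irr}(W)$ is the smallest $i$ such that $\chi$ occurs in $S^i(V)$. $\phi_{d,e}$ denotes an irreducible representation of dimension $d$ and fake degree $e$: $\mathrm{Irr}(W)=\{\phi_{1,0},\phi_{1,m}\}\cup\{\phi_{2,r}\mid1\le r\le(m-1)/2\}$ for $m$ odd and $\mathrm{Irr}(W)=\{\phi_{1,0},\phi_{1,m/2}',\phi_{1,m/2}'',\phi_{1,m}\}\cup\{\phi_{2,r}\mid1\le r\le m/2-1\}$ for $m$ even, where $\phi_{1,m/2}',\phi_{1,m/2}''$ are the two one-dimensional representations of fake degree $m/2$. **Green functions.** $\mathcal K(W)$ is the Grothendieck group, $\langle\cdot,\cdot\rangle$ the $\mathbb Q(q)$-bilinear form on $\mathcal K(W)_{\mathbb Q(q)}$ with $\mathrm{Irr}(W)$ orthonormal, $C(q)$ the coinvariant algebra of $W$ graded by $q$. Use a total order $\le_p$ on $\mathrm{Irr}(W)$ such that $\chi\le_p\chi'$ implies $b(\chi)\ge b(\chi')$ (unique for $m$ odd; for $m$ even take either order of $\phi_{1,m/2}',\phi_{1,m/2}''$). The Lusztig–Shoji algorithm produces unique $Q_\chi\in\mathcal K(W)_{\mathbb Q(q)}$ and nonzero $\lambda_\chi\in\mathbb Q(q)$ with $\langle Q_\chi,\chi\rangle=q^{b(\chi)}$,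 $\langle Q_\chi,\varphi\rangle=0$ unless $\varphi\ge_p\chi$, and $q^{m}\langle C(q)\otimes\varphi\otimes\mathrm{sgn},\psi\rangle=\sum_\chi\lambda_\chi\langle Q_\chi,\varphi\rangle\langle Q_\chi,\psi\rangle$ for all $\varphi,\psi\in\mathrm{Irr}(W)$. $\{Q_\chi\}$ is a basis of $\mathcal K(W)_{\mathbb Q(q)}$. **$q$-Kreweras numbers.** With $S^*(V)=\bigoplus_iS^i(V)q^i$, let $\mathcal H_t=\sum_{i=0}^2(-q^t)^iS^*(V)\otimes\wedge^iV\in\mathcal K(W)_{\mathbb Q(q)}$; $\mathrm{Krew}(W,\chi,t;q)\in\mathbb Q(q)$ is defined by $\mathcal H_t=\sum_\chi\mathrm{Krew}(W,\chi,t;q)Q_\chi$. *)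

(* Defs.v *)
From HB Require Import structures.
From mathcomp Require Import all_boot all_order all_algebra all_fingroup.
From mathcomp Require Import all_solvable all_field all_character.
From mathcomp Require classical_sets.

Set Implicit Arguments.
Unset Strict Implicit.
Unset Printing Implicit Defensive.

Import Order.TTheory GRing.Theory Num.Theory.
Local Open Scope ring_scope.

(* If e_0, e_1 is the standard basis of V = R^2, the basis of S^n(V) is        *)
(* e_0^(n-a) e_1^a for 0 <= a <= n.  Setting e_0 = 1 and e_1 = 'X identifies   *)
(* S^n(V) = 'rV_n.+1 with the polynomials of size at most n.+1 (via rVpoly),   *)
(* and the product S^k(V) x S^l(V) -> S^(k+l)(V) with the product of           *)
(* polynomials.  As matrices act on row vectors from the right, A maps e_i to  *)
(* row i A.                                                                    *)
Definition sym_img (R : comNzRingType) (n : nat) (A : 'M[R]_2) (a : nat) :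
    {poly R} :=
  rVpoly (row 0 A) ^+ (n - a) * rVpoly (row 1 A) ^+ a.

Definition sym_mx (R : comNzRingType) (n : nat) (A : 'M[R]_2) : 'M[R]_n.+1 :=
  \matrix_(a < n.+1) poly_rV (sym_img n A a).

Section SymTheory.

Variable R : comNzRingType.
Implicit Types (A B : 'M[R]_2) (f g : {poly R}).

Definition sym_sub n A f : {poly R} :=
  \sum_(a < n.+1) f`_a *: sym_img n A a.

Lemma size_lin (u : 'rV[R]_2) k : (size (rVpoly u ^+ k) <= k.+1)%N.
Proof.
apply: leq_trans (size_poly_exp_leq _ _) _; rewrite ltnS.
by rewrite -[leqRHS]mul1n leq_mul2r -subn1 leq_subLR size_poly orbT.
Qed.

Lemma size_sym_img n A a : (a <= n)%N -> (size (sym_img n A a) <= n.+1)%N.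
Proof.
move=> le_an; apply: leq_trans (size_polyMleq _ _) _.
have h1 := size_lin (row 0 A) (n - a); have h2 := size_lin (row 1 A) a.
rewrite -subn1 leq_subLR add1n; apply: leq_trans (leq_add h1 h2) _.
by rewrite addSn addnS subnK.
Qed.

Lemma size_sym_sub n A f : (size (sym_sub n A f) <= n.+1)%N.
Proof.
apply: leq_trans (size_sum _ _ _) _; apply/bigmax_leqP=> a _.
by apply: leq_trans (size_scale_leq _ _) (size_sym_img _ _); rewrite -ltnS.
Qed.

Lemma rVpoly_sym_mx n A (v : 'rV[R]_n.+1) :
  rVpoly (v *m sym_mx n A) = sym_sub n A (rVpoly v).
Proof.
rewrite mulmx_sum_row linear_sum; apply: eq_bigr => a _.
rewrite linearZ /= rowK coef_rVpoly_ord poly_rV_K //.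
by apply: size_sym_img; rewrite -ltnS.
Qed.

Lemma sym_subXn n A a : (a <= n)%N -> sym_sub n A 'X^a = sym_img n A a.
Proof.
move=> le_an; have lt_an: (a < n.+1)%N by [].
rewrite /sym_sub (bigD1 (Ordinal lt_an)) //= coefXn eqxx scale1r big1 ?addr0 //.
move=> b neq_ba; rewrite coefXn; have: (b : nat) != a by exact: neq_ba.
by move/negbTE->; rewrite scale0r.
Qed.

Lemma sym_subZD n A c f g :
  sym_sub n A (c *: f + g) = c *: sym_sub n A f + sym_sub n A g.
Proof.
rewrite /sym_sub scaler_sumr -big_split /=; apply: eq_bigr => a _.
by rewrite coefD coefZ scalerDl scalerA.
Qed.

Lemma sym_sub0 n A : sym_sub n A 0 = 0.
Proof. by rewrite /sym_sub big1 // => a _; rewrite coef0 scale0r. Qed.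

Lemma sym_sub_sum n A (I : Type) (r : seq I) (c : I -> R) (F : I -> {poly R}) :
  sym_sub n A (\sum_(i <- r) c i *: F i) = \sum_(i <- r) c i *: sym_sub n A (F i).
Proof.
elim: r => [|i r IHr]; first by rewrite !big_nil sym_sub0.
by rewrite !big_cons sym_subZD IHr.
Qed.

Lemma sym_subM n k A f g : (size f <= n.+1)%N -> (size g <= k.+1)%N ->
  sym_sub (n + k) A (f * g) = sym_sub n A f * sym_sub k A g.
Proof.
move=> sf sg.
have ex m (h : {poly R}) : (size h <= m.+1)%N -> h = \sum_(a < m.+1) h`_a *: 'X^a.
  move=> sh; rewrite -poly_def; apply/polyP=> i; rewrite coef_poly.
  by case: ltnP => // le_mi; rewrite nth_default // (leq_trans sh).
rewrite {1}(ex _ _ sf) {1}(ex _ _ sg) mulr_suml.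
under eq_bigr => a _ do rewrite -scalerAl.
rewrite sym_sub_sum /sym_sub mulr_suml; apply: eq_bigr => a _.
rewrite -scalerAl; congr (_ *: _); rewrite -/(sym_sub _ _ _) mulr_sumr.
under eq_bigr => b _ do rewrite -scalerAr -exprD.
rewrite sym_sub_sum mulr_sumr; apply: eq_bigr => b _.
have la : (a <= n)%N by rewrite -ltnS.
have lb : (b <= k)%N by rewrite -ltnS.
rewrite -scalerAr; congr (_ *: _); rewrite sym_subXn ?leq_add // /sym_img.
by rewrite mulrACA -!exprD addnBAC // addnBA // subnDA subnAC.
Qed.

Lemma sym_sub1 A (u : 'rV[R]_2) : sym_sub 1 A (rVpoly u) = rVpoly (u *m A).
Proof.
rewrite /sym_sub mulmx_sum_row linear_sum; apply: eq_bigr => -[a lt_a] _.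
rewrite linearZ coef_rVpoly_ord /sym_img /=; congr (_ *: _).
case: a lt_a => [|[|//]] lt_a; rewrite expr0 expr1 ?mulr1 ?mul1r;
  by congr (rVpoly (row _ A)); apply/val_inj.
Qed.

Lemma sym_subX A (u : 'rV[R]_2) k :
  sym_sub k A (rVpoly u ^+ k) = rVpoly (u *m A) ^+ k.
Proof.
elim: k => [|k IHk].
  by rewrite !expr0 -[1 in LHS](expr0 'X) sym_subXn // /sym_img !expr0 mulr1.
rewrite !exprS -add1n sym_subM ?size_lin //; last exact: size_poly.
by rewrite sym_sub1 IHk.
Qed.

Lemma sym_mxM n A B : sym_mx n (A *m B) = sym_mx n A *m sym_mx n B.
Proof.
apply/row_matrixP=> a; rewrite row_mul !rowK; have la: (a <= n)%N by rewrite -ltnS.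
apply: (can_inj rVpolyK); rewrite rVpoly_sym_mx !poly_rV_K ?size_sym_img //.
rewrite /sym_img -[X in sym_sub X](subnK la) sym_subM ?size_lin //.
by rewrite !sym_subX !row_mul.
Qed.

Lemma sym_mx1 n : sym_mx n 1%:M = 1%:M :> 'M[R]_n.+1.
Proof.
apply/row_matrixP=> a; rewrite rowK row1 /sym_img !row1 !rVpoly_delta.
rewrite expr0 expr1n mul1r expr1 -rVpoly_delta.
exact: rVpolyK.
Qed.

End SymTheory.

Section GradedReps.

Variables (gT : finGroupType) (W : {group gT}).
Variable rV : mx_representation algC W 2.

Lemma sym_mx_repr n : mx_repr W (fun g => sym_mx n (rV g)).
Proof.
split=> [|x y Wx Wy]; first by rewrite repr_mx1 sym_mx1.
by rewrite repr_mxM // sym_mxM.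
Qed.

Definition sym_repr n : mx_representation algC W n.+1 :=
  MxRepresentation (sym_mx_repr n).

(* Degree n part of the ideal of S(V) generated by the invariants of positive  *)
(* degree: it is spanned by the products of an invariant of degree k.+1 and a  *)
(* monomial of degree n - k.+1, for k < n.                                     *)
Definition hilbert_ideal n : 'M[algC]_n.+1 :=
  (\sum_(k < n) \sum_(i < k.+2) \sum_(j < n - k)
     <<poly_rV (rVpoly (row i (rfix_mx (sym_repr k.+1) W)) * 'X^j)
         : 'rV[algC]_n.+1>>)%MS.

Lemma hilbert_ideal_module n : mxmodule (sym_repr n) (hilbert_ideal n).
Proof.
apply/mxmoduleP=> x Wx; rewrite /hilbert_ideal.
rewrite sumsmxMr; apply/sumsmx_subP=> k _.
rewrite sumsmxMr; apply/sumsmx_subP=> i _.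
rewrite sumsmxMr; apply/sumsmx_subP=> j _.
rewrite (eqmxMr _ (genmxE _)).
set F := rfix_mx _ _; have lt_kn := ltn_ord k.
have fixF: row i F *m sym_mx k.+1 (rV x) = row i F.
  by rewrite -row_mul; congr (row i _); apply: (rfix_mx_id (sym_repr k.+1)).
have le_j: (j <= n - k.+1)%N by rewrite subnS -ltnS prednK ?subn_gt0.
have szM (p : {poly algC}) : (size p <= (n - k.+1).+1)%N ->
    (size (rVpoly (row i F) * p)%R <= n.+1)%N.
  move=> sp; apply: leq_trans (size_polyMleq _ _) _.
  rewrite -subn1 leq_subLR add1n.
  apply: leq_trans (leq_add (size_poly _ _) sp) _.
  by rewrite addSn addnS subnKC.
have szX : (size ('X^j : {poly algC}) <= (n - k.+1).+1)%N by rewrite size_polyXn.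
have ->: poly_rV (rVpoly (row i F) * 'X^j) *m sym_repr n x =
    poly_rV (rVpoly (row i F) * sym_sub (n - k.+1) (rV x) 'X^j) :> 'rV_n.+1.
  apply: (can_inj rVpolyK); rewrite rVpoly_sym_mx !poly_rV_K ?szM ?size_sym_sub //.
  rewrite -[X in sym_sub X](subnKC lt_kn) sym_subM ?size_poly //.
  by rewrite -rVpoly_sym_mx fixF.
set p := sym_sub _ _ _.
have ->: p = \sum_(a < n - k) p`_a *: 'X^a.
  rewrite -poly_def; apply/polyP=> a; rewrite coef_poly; case: ltnP => // le_a.
  rewrite nth_default //; apply: leq_trans (size_sym_sub _ _ _) _.
  by rewrite subnS prednK ?subn_gt0.
rewrite mulr_sumr linear_sum summx_sub // => a _.
rewrite -scalerAr linearZ scalemx_sub //.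
apply: (sumsmx_sup k) => //; apply: (sumsmx_sup i) => //.
by apply: (sumsmx_sup a) => //; rewrite genmxE.
Qed.

(* The degree n part of S(V) / (S(V)^W_+). *)
Definition coinv_repr n := factmod_repr (hilbert_ideal_module n).

Definition sym_char n : 'CF(W) := cfRepr (sym_repr n).
Definition coinv_char n : 'CF(W) := cfRepr (coinv_repr n).

(* Characters of wedge^0 V, wedge^1 V, wedge^2 V; the last one is det = sgn. *)
Definition ext_char (i : nat) : 'CF(W) :=
  match i with 0 => 1 | 1 => cfRepr rV | 2 => detRepr rV | _ => 0 end.

Definition fake_degree (i : Iirr W) : nat :=
  classical_sets.xget 0%N (fun d : nat =>
    i \in irr_constt (sym_char d) /\
    forall e : nat, i \in irr_constt (sym_char e) -> (d <= e)%N).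

(* 'chi_i is (one of) the irreducible(s) phi_{d,e}. *)
Definition is_phi (d e : nat) (i : Iirr W) : Prop :=
  'chi_i 1%g = d%:R /\ fake_degree i = e.

End GradedReps.

Definition Qq : fieldType := {fraction {poly rat}}.
Definition q : Qq := tofrac ('X : {poly rat}).

Definition qint (k : int) : Qq := (q ^ k - 1) / (q - 1).

(* f is the rational function whose power series expansion at q = 0 is         *)
(* \sum_n a_n q^n: f = p / d with d(0) != 0 and d * (\sum_n a_n q^n) = p.      *)
Definition expands_to (a : nat -> rat) (f : Qq) : Prop :=
  exists p d : {poly rat},
    [/\ d`_0 != 0, f = tofrac p / tofrac d
      & forall n : nat, \sum_(i < n.+1) d`_i * a (n - i)%N = p`_n].

(* Such an f is unique when it exists; the value 0 is a default. *)
Definition series_sum (a : nat -> rat) : Qq :=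
  classical_sets.xget 0 (expands_to a).

Section Grothendieck.

Variables (gT : finGroupType) (W : {group gT}).

(* K(W)_{Q(q)}, by coordinates in the basis Irr(W). *)
Definition KW : vectType Qq := {ffun Iirr W -> Qq^o}.

Definition Kdot (x y : KW) : Qq := \sum_i x i * y i.

Definition mult (phi : 'CF(W)) (i : Iirr W) : nat := Num.truncn '[phi, 'chi_i].

(* Only meaningful for genuine characters, where '[phi, 'chi_i] is a natural. *)
Definition Kclass (phi : 'CF(W)) : KW := [ffun i => (mult phi i)%:R].

(* The class \sum_n [M_n] q^n of a graded representation M with character     *)
(* M_n in degree n.                                                            *)
Definition Kgraded (M : nat -> 'CF(W)) : KW :=
  [ffun i => series_sum (fun n => (mult (M n) i)%:R)].

Variable rV : mx_representation algC W 2.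

(* The properties that determine the output (Q, lambda) of the Lusztig-Shoji   *)
(* algorithm for the order le; N is the number of reflections of W, and        *)
(* ext_char rV 2 is sgn.                                                       *)
Definition lusztig_shoji (N : nat) (le : rel (Iirr W))
    (Q : Iirr W -> KW) (lambda : Iirr W -> Qq) : Prop :=
  [/\ forall i, lambda i != 0,
      forall i, Kdot (Q i) (Kclass 'chi_i) = q ^+ fake_degree rV i,
      forall i j, ~~ le i j -> Kdot (Q i) (Kclass 'chi_j) = 0
    & forall j k,
        q ^+ N * Kdot (Kgraded (fun n => coinv_char rV n * 'chi_j * ext_char rV 2))
                      (Kclass 'chi_k)
        = \sum_i lambda i * Kdot (Q i) (Kclass 'chi_j)
                          * Kdot (Q i) (Kclass 'chi_k)].

Definition fake_degree_order (le : rel (Iirr W)) : Prop :=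
  [/\ reflexive le, antisymmetric le, transitive le, total le
    & forall i j, le i j -> (fake_degree rV j <= fake_degree rV i)%N].

(* sum_(i <= 2) (- q^t)^i S^*(V) (x) wedge^i V *)
Definition Koszul (t : nat) : KW :=
  \sum_(i < 3) (- q ^+ t) ^+ i *:
     Kgraded (fun n => sym_char rV n * ext_char rV i).

(* The coefficient of Q_i when Koszul t is written in the basis (Q_i). *)
Definition Krew (Q : Iirr W -> KW) (t : nat) (i : Iirr W) : Qq :=
  coord [tuple Q j | j < Nirr W] i (Koszul t).

End Grothendieck.

(* m.-root (-1) is the m-th root of -1 of least argument, i.e. exp(i pi / m).  *)
Definition cos_pi_over (m : nat) : algC := 'Re (m.-root (-1)).

Definition I2_form (m : nat) (i j : 'I_2) : algC :=
  if i == j then 1 else - cos_pi_over m.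

(* The simple reflection s_i in the basis of simple roots:                     *)
(* alpha_j |-> alpha_j - 2 B(alpha_i, alpha_j) alpha_i.                        *)
Definition I2_reflection (m : nat) (i : 'I_2) : 'M[algC]_2 :=
  \matrix_(j, k) ((j == k)%:R - 2 * I2_form m i j * (i == k)%:R).

(* For m >= 2 this says that (W, {s0, s1}) is the Coxeter system of type       *)
(* I_2(m).                                                                     *)
Definition I2_system (m : nat) (gT : finGroupType) (W : {group gT})
    (s0 s1 : gT) : Prop :=
  [/\ <<[set s0; s1]>>%g = W, #[s0]%g = 2%N, #[s1]%g = 2%N, #[s0 * s1]%g = m
    & #|W| = m.*2].

Definition is_reflection_repr (m : nat) (gT : finGroupType) (W : {group gT})
    (s0 s1 : gT) (rV : mx_representation algC W 2) : Prop :=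
  rV s0 = I2_reflection m 0 /\ rV s1 = I2_reflection m 1.

(* Main.v *)
Require Import Defs.
From mathcomp Require Import all_boot all_order all_algebra all_fingroup.
From mathcomp Require Import all_solvable all_field all_character ring zify.
Set Implicit Arguments.
Unset Strict Implicit.
Unset Printing Implicit Defensive.
Import Order.TTheory GRing.Theory Num.Theory.
Local Open Scope ring_scope.

(** Let D = (1 - q^2) (1 - q^m), let C be the graded coinvariant algebra and
    write sgn, V for the sign and the reflection character.  In the ring of
    polynomials in q with coefficients in the representation ring, the Koszul
    complex of S(V) and the equality S(V) D = C give

      (1 - q V + q^2 sgn) C = D                               ([koszul_coinv]).

    Hence the matrix Omega of the Lusztig-Shoji algorithm, which is tensoring
    with q^m C sgn, has the explicit inverse sgn (1 - q V + q^2 sgn) / (q^m D).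

    The Green function of an irreducible character chi of fake degree b is the
    truncation of the coinvariant algebra

      P = sum_(n < b) C_n q^n + chi q^b                       ([green]).

    By definition of the fake degree, P is supported on characters that are not
    below chi, with coefficient q^b at chi.  Conversely P = Omega y for
    y = sgn (1 - q V + q^2 sgn) P / (q^m D): as C_n V = C_(n-1) + C_(n+1) in the
    middle degrees, the product telescopes to a sum of at most four terms, all
    supported on characters not above chi ([dual_green_cases],
    [dual_green_support]).  By triangularity these two properties force Q_chi = P
    and lambda_chi q^b y_chi = 1 ([triangular_unique], [green_unique]).

    Finally the class expanded by the q-Kreweras numbers is
    S(V) (1 - q^t V + q^2t sgn) = Omega (sgn - q^t V + q^2t) / (q^m D), so that

      Krew(chi) = lambda_chi (<P, sgn> - q^t <P, V> + q^2t <P, 1>) / (q^m D)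

    ([Krew_green]), and everything is read off from the values of P at 1, V and
    sgn and the value of y at chi ([green_values]).

    It remains to know the characters.  The rotations of W act diagonally on
    suitable linear forms x and y, with eigenvalues the powers of
    exp(2 i pi / m) and their inverses, and the reflections exchange the lines
    of x and y.  So the invariants of degree at most m are the polynomials in xy
    and x^m + y^m, the space C_n has the basis x^n, y^n for 0 < n < m, and C_m
    is a line that affords the sign. *)

(** * The root of unity exp(i pi / m) *)

(** If th = a + i b and w = c + i d lie on the unit circle, then w / th has real
    part a c + b d and imaginary part a d - b c. *)
Lemma circle_step (a b c d : algC) : a \is Num.real -> c \is Num.real ->
    0 <= b -> 0 <= d -> a ^+ 2 + b ^+ 2 = 1 -> c ^+ 2 + d ^+ 2 = 1 ->
    c <= a -> a < 1 ->
  c < a * c + b * d /\ 0 <= a * d - b * c.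
Proof.
move=> Ra Rc b0 d0 ab cd le_ca lt_a1.
have a1 : 0 < 1 - a by rewrite subr_gt0.
have eb : b ^+ 2 = 1 - a ^+ 2 by rewrite -ab addrAC subrr add0r.
have ed : d ^+ 2 = 1 - c ^+ 2 by rewrite -cd addrAC subrr add0r.
have sq (x y : algC) : 0 <= x -> 0 <= y -> (x ^+ 2 <= y ^+ 2) = (x <= y).
  by move=> x0 y0; rewrite ler_sqr.
have eqc : a * c + b * d - c = b * d - c * (1 - a) by ring.
rewrite -subr_gt0 eqc; case: (real_ltP (real0 _) Rc) => [c0 | c0].
  have a0 : 0 < a := lt_le_trans c0 le_ca.
  have le_bd : b <= d.
    by rewrite -sq // eb ed lerD2l lerN2 sq // ltW.
  split.
    apply: (@lt_le_trans _ _ (b * b - c * (1 - a))).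
      rewrite -expr2 eb (_ : _ - _ = (1 - a) * (1 + (a - c))); last by ring.
      by rewrite mulr_gt0 // ltr_wpDr // subr_ge0.
    by rewrite lerD2r ler_wpM2l.
  rewrite subr_ge0 (le_trans (y := b * a)) ?ler_wpM2l // mulrC.
  by rewrite ler_wpM2l // ltW.
have bd0 : 0 <= b * d by rewrite mulr_ge0.
have ca0 : 0 <= - c * (1 - a) by rewrite mulr_ge0 ?oppr_ge0 // ltW.
have s0 : 0 <= b * d - c * (1 - a) by rewrite -mulNr addr_ge0.
split.
  rewrite lt_def s0 andbT -mulNr paddr_eq0 //; apply/negP.
  case/andP; rewrite !mulf_eq0 oppr_eq0 (gt_eqF a1) orbF => bd /eqP cz.
  have d2 : d ^+ 2 = 1 by rewrite ed cz expr0n subr0.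
  have dn0 : d != 0 by rewrite -sqrf_eq0 d2 oner_eq0.
  move: bd; rewrite (negbTE dn0) orbF => /eqP bz.
  have: (1 - a) * (1 + a) = 0.
    by rewrite -[X in _ * X]opprK mulrN -mulrN opprK -subr_sqr expr1n -eb bz expr0n.
  apply/eqP; rewrite mulf_eq0 (gt_eqF a1) gt_eqF //.
  by rewrite ltr_pwDl // -cz.
case: (real_leP (real0 _) Ra) => a0.
  by rewrite addr_ge0 ?mulr_ge0 // -mulrN mulr_ge0 // oppr_ge0.
have le_db : d <= b.
  rewrite -sq // eb ed lerD2l lerN2 -[a ^+ 2]sqrrN -[c ^+ 2]sqrrN.
  by rewrite sq ?oppr_ge0 ?lerN2 // ltW.
rewrite addrC -mulrN -[a * d]opprK -mulNr subr_ge0.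
apply: (@le_trans _ _ (- c * d)); first by rewrite ler_wpM2r // lerN2.
by rewrite mulrC ler_wpM2r // oppr_ge0.
Qed.

(** The solution of [z ^+ m = -1] of largest real part in the upper half plane
    is exp(i pi / m), hence a primitive root of order [2m].  Among the
    nontrivial [2m]-th roots of unity in the upper half plane, let [th] have
    the largest real part.  Dividing another one by [th] stays in the upper
    half plane and increases the real part, so all are powers of [th]; hence
    [th] is primitive, [th ^+ m = -1], and [th] is the root looked for. *)
Lemma rootCN1_prim m : (1 < m)%N -> (m.*2).-primitive_root (m.-root (-1) : algC).
Proof.
move=> m1; set z := _.-root _; set n := m.*2.
have n0 : (0 < n)%N by rewrite double_gt0 ltnW.
have n2E (w : algC) : w ^+ n = (w ^+ m) ^+ 2 by rewrite -exprM muln2.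
have zm : z ^+ m = -1 by rewrite rootCK // ltnW.
have Imz : 0 <= 'Im z by apply: Im_rootC_ge0.
have neqN1 : (-1 : algC) != 1 by rewrite lt_eqF // (lt_trans (ltrN10 _) ltr01).
have zn : z ^+ n = 1 by rewrite n2E zm sqrrN expr1n.
have z1 : z != 1 by apply: contra neqN1 => /eqP zE; rewrite -zm zE expr1n.
have [om om_prim] := C_prim_root_exists n0.
have omn : om ^+ n = 1 by apply: prim_expr_order.
have circ (w : algC) : w ^+ n = 1 -> 'Re w ^+ 2 + 'Im w ^+ 2 = 1.
  move=> wn; rewrite -normC2_Re_Im; have: `|w| ^+ n = 1 by rewrite -normrX wn normr1.
  by move/eqP; rewrite pexpr_eq1 // => /eqP->; rewrite expr1n.
pose P := [pred k : 'I_n | (om ^+ k != 1) && (0 <= 'Im (om ^+ k))].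
have [kz zE] := prim_rootP om_prim zn.
have Pkz : P kz by rewrite /= -zE z1.
have ReR : {in P, forall k : 'I_n, 'Re (om ^+ k) \is Num.real} by move=> k _; apply: Creal_Re.
case: (real_arg_maxP Pkz ReR) => k0 /andP[th1 Imth] thmax.
set th := om ^+ k0 in th1 Imth thmax.
have thn : th ^+ n = 1 by rewrite /th exprAC omn expr1n.
have {}thmax w : w ^+ n = 1 -> w != 1 -> 0 <= 'Im w -> 'Re w <= 'Re th.
  move=> wn w1 Imw; have [k wE] := prim_rootP om_prim wn.
  by rewrite wE; apply: thmax; rewrite /= -wE w1.
have th0 : th != 0 by apply: contra_eq_neq thn => ->; rewrite expr0n gtn_eqF // eq_sym oner_eq0.
have thV : th^-1 = th^*.
  by rewrite invC_norm normC2_Re_Im circ // invr1 mul1r.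
have Reth : 'Re th < 1.
  have c := circ _ thn.
  have le1 : 'Re th ^+ 2 <= 1 by rewrite -c lerDl -realEsqr Creal_Im.
  have : 'Re th <= 1.
    apply: le_trans (real_ler_norm (Creal_Re _)) _.
    by rewrite -(@ler_sqr algC) ?nnegrE ?normr_ge0 // expr1n real_normK ?Creal_Re.
  rewrite le_eqVlt => /orP[/eqP Re1|//]; case/eqP: th1.
  move: c; rewrite Re1 expr1n => /eqP; rewrite -subr_eq0 addrAC subrr add0r.
  rewrite sqrf_eq0 => /eqP Im0.
  by rewrite [th]Crect Re1 Im0 mulr0 addr0.
have powers w : w ^+ n = 1 -> 0 <= 'Im w -> exists j, w = th ^+ j.
  move=> wn Imw; have [k wE] := prim_rootP om_prim wn; subst w.
  pose B := [pred k : 'I_n | (0 <= 'Im (om ^+ k)) && [forall j : 'I_n, om ^+ k != th ^+ j]].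
  have [Bk|] := boolP (B k); last first.
    by rewrite /= Imw negb_forall => /existsP[j]; rewrite negbK => /eqP->; exists j.
  have ReB : {in B, forall k : 'I_n, 'Re (om ^+ k) \is Num.real} by move=> j _; apply: Creal_Re.
  case: (real_arg_maxP Bk ReB) => k1 /andP[Im1 /forallP not_pow] k1max.
  set w := om ^+ k1 in Im1 not_pow k1max.
  have w1n : w ^+ n = 1 by rewrite /w exprAC omn expr1n.
  have w1 : w != 1 by apply: (not_pow (Ordinal n0)).
  have := circle_step (Creal_Re _) (Creal_Re _) Imth Im1 (circ _ thn) (circ _ w1n)
    (thmax _ w1n w1 Im1) Reth.
  set w' := w / th.
  have ReE : 'Re th * 'Re w + 'Im th * 'Im w = 'Re w'.
    by rewrite /w' thV ReM Re_conj Im_conj mulrN opprK mulrC ['Im th * _]mulrC.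
  have ImE : 'Re th * 'Im w - 'Im th * 'Re w = 'Im w'.
    by rewrite /w' thV ImM Re_conj Im_conj mulrN addrC ['Im th * _]mulrC.
  rewrite ReE ImE => -[Re_lt Im_ge].
  have w'n : w' ^+ n = 1 by rewrite exprMn exprVn thn w1n invr1 mulr1.
  have [k' wE'] := prim_rootP om_prim w'n.
  have [Bk'|] := boolP (B k').
    by have := k1max _ Bk'; rewrite -wE' => /(lt_le_trans Re_lt); rewrite ltxx.
  rewrite /= -wE' Im_ge negb_forall => /existsP[j]; rewrite negbK => /eqP wj.
  have wS : w = th ^+ j.+1 by rewrite exprSr -wj divfK.
  have th_mod i : th ^+ i = th ^+ (i %% n).
    by rewrite {1}(divn_eq i n) exprD mulnC exprM thn expr1n mul1r.
  have := not_pow (Ordinal (ltn_pmod j.+1 n0)).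
  by rewrite /= -th_mod wS eqxx.
have th_prim : n.-primitive_root th.
  have [d d_prim dn] := prim_order_exists n0 thn.
  have thd := prim_expr_order d_prim.
  suff: om ^+ d = 1.
    move/eqP; rewrite -(prim_order_dvd om_prim) => nd.
    by rewrite (_ : n = d) //; apply/eqP; rewrite eqn_dvd nd dn.
  case: (real_ge0P (Creal_Im om)) => [Im0|Im0].
    have [j ->] := powers _ omn Im0; by rewrite exprAC thd expr1n.
  have cn : om^* ^+ n = 1 by rewrite -rmorphXn omn rmorph1.
  have [|j cE] := powers _ cn; first by rewrite Im_conj oppr_ge0 ltW.
  by rewrite -[om]conjCK cE -rmorphXn exprAC thd expr1n rmorph1.
have thm : th ^+ m = -1.
  have: (th ^+ m) ^+ 2 = 1 by rewrite -n2E.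
  move/eqP; rewrite sqrf_eq1 => /orP[|/eqP//].
  rewrite -(prim_order_dvd th_prim) => /dvdn_leq; rewrite /n -addnn => /(_ (ltnW m1)).
  by rewrite -[leqRHS]addn0 leq_add2l leqNgt ltnW.
have ReE : 'Re z = 'Re th.
  apply/le_anti; rewrite thmax //=.
  by apply: rootC_Re_max thm Imth; apply: ltnW.
have ImE : 'Im z = 'Im th.
  have := circ _ zn; rewrite -(circ _ thn) ReE => /addrI/eqP.
  by rewrite eqrXn2 // => /eqP.
by rewrite [z]Crect ReE ImE -Crect.
Qed.

(** * Symmetric powers of monomial matrices; traces on quotients *)

Section MonomialMatrices.

Variable R : comNzRingType.
Implicit Types (a b : R) (A : 'M[R]_2).

Definition diag2 a b : 'M[R]_2 := \matrix_(i, j) (if i == j then if i == 0 then a else b else 0).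
Definition anti2 a b : 'M[R]_2 := \matrix_(i, j) (if i != j then if i == 0 then a else b else 0).

Lemma sym_mx_eq_entry n A i j : sym_mx n A i j = (sym_img n A i)`_j.
Proof. by rewrite !mxE. Qed.

Lemma rVpoly2 (u : 'rV[R]_2) : rVpoly u = (u 0 0)%:P + (u 0 1)%:P * 'X.
Proof.
apply/polyP=> i; rewrite coef_rVpoly coefD coefC coefCM coefX.
case: insubP => [[j lt_j] _ /= <-|]; last first.
  by rewrite -leqNgt; case: i => [|[|i]] //= _; rewrite mulr0 addr0.
case: j lt_j => [|[|//]] lt_j /=; rewrite ?mulr0 ?mulr1 ?addr0 ?add0r;
  by congr (u 0 _); apply: val_inj.
Qed.

Lemma sym_diag2 n a b (i j : 'I_n.+1) :
  sym_mx n (diag2 a b) i j = if i == j then a ^+ (n - i) * b ^+ i else 0.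
Proof.
rewrite sym_mx_eq_entry /sym_img !rVpoly2 !mxE /= mul0r addr0 add0r exprMn -!polyC_exp.
rewrite mulrA -polyCM coefCM coefXn -[i == j]val_eqE eq_sym /=.
by case: eqP => _; rewrite ?mulr1 ?mulr0.
Qed.

Lemma sym_anti2 n a b (i j : 'I_n.+1) :
  sym_mx n (anti2 a b) i j = if i == rev_ord j then a ^+ (n - i) * b ^+ i else 0.
Proof.
rewrite sym_mx_eq_entry /sym_img !rVpoly2 !mxE /= mul0r addr0 add0r exprMn -!polyC_exp.
rewrite mulrAC -polyCM coefCM coefXn -val_eqE /= subSS.
have -> : (j == n - i :> nat)%N = (i == n - j :> nat)%N.
  by apply/eqP/eqP => ->; rewrite subKn // -ltnS.
by case: eqP => _; rewrite ?mulr1 ?mulr0.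
Qed.

Lemma tr_sym_diag2 n a b :
  \tr (sym_mx n (diag2 a b)) = \sum_(i < n.+1) a ^+ (n - i) * b ^+ i.
Proof. by apply: eq_bigr => i _; rewrite sym_diag2 eqxx. Qed.

Lemma tr_sym_diag2_rec n a b : a * b = 1 ->
  \tr (sym_mx n.+2 (diag2 a b)) = \tr (sym_mx n (diag2 a b)) + (a ^+ n.+2 + b ^+ n.+2).
Proof.
move=> ab; rewrite !tr_sym_diag2 big_ord_recl big_ord_recr /= expr0 mulr1.
rewrite addrCA subSS subnn expr0 mul1r; congr (_ + _).
apply: eq_bigr => i _; rewrite /bump /= add1n subSS subSn ?leq_ord //.
by rewrite (exprS a) (exprS b) mulrACA ab mul1r.
Qed.

Lemma tr_sym_anti2 n a b : a * b = 1 -> \tr (sym_mx n (anti2 a b)) = (~~ odd n)%:R.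
Proof.
move=> ab; case on: (odd n) => /=.
  apply: big1 => i _; rewrite sym_anti2 -val_eqE /= subSS; case: eqP => // iE.
  have ii : (i + i)%N = n by rewrite [X in (X + _)%N]iE subnK ?leq_ord.
  by move: on; rewrite -[X in odd X]ii addnn odd_double.
have nE : n = n./2.*2 by rewrite -[LHS]odd_double_half on.
set h := n./2 in nE; have lt_k : (h < n.+1)%N by rewrite ltnS nE -addnn leq_addr.
have nh : (n - h)%N = h by rewrite nE -addnn addnK.
rewrite /mxtrace (bigD1 (Ordinal lt_k)) //= big1 ?addr0 => [|i].
  by rewrite sym_anti2 -val_eqE /= subSS nh eqxx -exprMn ab expr1n.
rewrite -val_eqE /= sym_anti2 -val_eqE /= subSS => /eqP neq_ih.
case: eqP => //= iE; case: neq_ih.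
apply: double_inj; rewrite -nE -addnn.
by rewrite [X in (X + _)%N]iE subnK ?leq_ord.
Qed.

Lemma mul_anti2 a b a' b' : anti2 a b *m anti2 a' b' = diag2 (a * b') (b * a').
Proof.
apply/matrixP=> i j; rewrite !mxE !big_ord_recl big_ord0 !mxE.
by case: i => [[|[|//]] lti]; case: j => [[|[|//]] ltj] /=;
  rewrite ?(mul0r, mulr0, addr0, add0r).
Qed.

Lemma mul_diag2 a b a' b' : diag2 a b *m diag2 a' b' = diag2 (a * a') (b * b').
Proof.
apply/matrixP=> i j; rewrite !mxE !big_ord_recl big_ord0 !mxE.
by case: i => [[|[|//]] lti]; case: j => [[|[|//]] ltj] /=;
  rewrite ?(mul0r, mulr0, addr0, add0r).
Qed.

Lemma mul_diag2_anti2 a b a' b' : diag2 a b *m anti2 a' b' = anti2 (a * a') (b * b').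
Proof.
apply/matrixP=> i j; rewrite !mxE !big_ord_recl big_ord0 !mxE.
by case: i => [[|[|//]] lti]; case: j => [[|[|//]] ltj] /=;
  rewrite ?(mul0r, mulr0, addr0, add0r).
Qed.

Lemma diag2_1 : diag2 1 1 = 1%:M.
Proof. by apply/matrixP=> i j; rewrite !mxE; case: (i == j) => //; case: ifP. Qed.

Lemma det2 A : \det A = A 0 0 * A 1 1 - A 0 1 * A 1 0.
Proof.
rewrite (expand_det_row A 0) !big_ord_recl big_ord0 addr0 /cofactor !det_mx11 !mxE /=.
rewrite expr0 expr1 mul1r mulN1r mulrN; congr (A _ _ * A _ _ - A _ _ * A _ _); exact: val_inj.
Qed.

End MonomialMatrices.

(** A module homomorphism with a linear section and kernel [U] identifies the
    quotient by [U] with the target, so their traces agree. *)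
Lemma mxtrace_factmod (F : fieldType) (gT : finGroupType) (G : {group gT}) n
    (rG : mx_representation F G n) (U : 'M_n) (Umod : mxmodule rG U) k
    (E : 'M_(n, k)) (u : 'M_(k, n)) (M : 'M_k) g :
  g \in G -> u *m E = 1%:M -> (U :=: kermx E)%MS -> rG g *m E = E *m M ->
  \tr (factmod_repr Umod g) = \tr M.
Proof.
move=> Gg uE eqU EM; pose p := in_factmod U (1%:M : 'M_n).
pose v := val_factmod (1%:M : 'M_(\rank (cokermx U))) : 'M_(_, n).
have inE l (W : 'M_(l, n)) : in_factmod U W = W *m p by rewrite in_factmodE.
have vp : v *m p = 1%:M by rewrite -inE val_factmodK.
have pJ : rG g *m p = p *m factmod_repr Umod g by rewrite -inE -in_factmodJ // mul1mx.
have killp l (W : 'M_(l, n)) : (W *m p == 0) = (W *m E == 0).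
  by rewrite -inE in_factmod_eq0 eqU sub_kermx.
have pvE : p *m v *m E = E.
  apply/eqP; rewrite -[X in _ == X]mul1mx -subr_eq0 -mulmxBl -killp.
  by rewrite mulmxBl -mulmxA vp mulmx1 mul1mx subrr.
have Eup : E *m u *m p = p.
  apply/eqP; rewrite -[X in _ == X]mul1mx -subr_eq0 -mulmxBl killp.
  by rewrite mulmxBl -mulmxA uE mulmx1 mul1mx subrr.
have factE : factmod_repr Umod g = v *m rG g *m p by rewrite -mulmxA pJ mulmxA vp mul1mx.
rewrite factE; clear inE vp pJ killp factE; clearbody p v.
rewrite -Eup !mulmxA -(mulmxA v) EM mulmxA -!(mulmxA (v *m E)).
by rewrite mxtrace_mulC -!mulmxA (mulmxA p) pvE uE mulmx1.
Qed.

(** * The dihedral group and its symmetric powers *)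

Section Dihedral.

Variables (m : nat) (gT : finGroupType) (W : {group gT}) (s0 s1 : gT).
Hypotheses (m1 : (1 < m)%N) (hW : I2_system m W s0 s1).

Let c := (s0 * s1)%g.

Let oc : #[c]%g = m. Proof. by case: hW. Qed.

Lemma s0_in : s0 \in W.
Proof. by case: hW => <- *; rewrite mem_gen // !inE eqxx. Qed.

Lemma s1_in : s1 \in W.
Proof. by case: hW => <- *; rewrite mem_gen // !inE eqxx orbT. Qed.

Lemma rotX_in a : (c ^+ a)%g \in W.
Proof. by rewrite groupX // groupM ?s0_in ?s1_in. Qed.

Let s0_notin : s0 \notin <[c]>%g.
Proof.
apply/negP=> s0c; case: hW => genW _ _ _ oW.
have s1c : s1 \in <[c]>%g by rewrite -(mulKg s0 s1) groupM ?groupV ?cycle_id.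
have : W \subset <[c]>%g.
  by rewrite -genW gen_subG; apply/subsetP=> x; rewrite !inE => /orP[] /eqP->.
move/subset_leq_card; rewrite oW -[#|_|]/(#[c]%g) oc -addnn -[leqRHS]addn0 leq_add2l.
by rewrite leqNgt ltnW.
Qed.

Let cycleE : <[c]>%g = [set (c ^+ (a : 'I_m))%g | a : 'I_m].
Proof.
apply/setP=> x; apply/idP/imsetP => [/cyclePmin[a]|[a _ ->]]; last exact: mem_cycle.
by rewrite oc => lt_a ->; exists (Ordinal lt_a).
Qed.

Let WE : (<[c]> :|: <[c]> :* s0)%g = W.
Proof.
case: hW => _ _ _ _ oW; apply/eqP; rewrite eqEcard; apply/andP; split.
  have sub : <[c]>%g \subset W by rewrite cycle_subG (rotX_in 1).
  rewrite subUset sub; apply/subsetP=> x /rcosetP[y cy ->].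
  by rewrite groupM ?s0_in // (subsetP sub).
rewrite cardsU card_rcoset (_ : _ :&: _ = set0) ?cards0 ?subn0 ?oW -?addnn.
  by rewrite -[#|_|]/(#[c]%g) oc.
apply/setP=> x; rewrite !inE; apply/negP=> /andP[cx /rcosetP[y cy xE]].
by case/negP: s0_notin; rewrite -(mulKg y s0) -xE groupM ?groupV.
Qed.

Lemma dihedralP g : g \in W -> exists a, g = (c ^+ a)%g \/ g = (c ^+ a * s0)%g.
Proof.
rewrite -WE !inE => /orP[/cycleP[a ->]|/rcosetP[y /cycleP[a ->] ->]].
  by exists a; left.
by exists a; right.
Qed.

Lemma sum_dihedral (F : gT -> algC) :
  \sum_(g in W) F g = \sum_(a < m) F (c ^+ a)%g + \sum_(a < m) F (c ^+ a * s0)%g.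
Proof.
have sumc (G : gT -> algC) : \sum_(g in <[c]>%g) G g = \sum_(a < m) G (c ^+ a)%g.
  rewrite cycleE big_imset //= => a b _ _ /eqP.
  by rewrite eq_expg_mod_order oc !modn_small // => /eqP/val_inj.
rewrite -WE (eq_bigl _ _ (fun x => in_setU x _ _)) bigU /=; last first.
  rewrite disjoints_subset; apply/subsetP=> x cx; rewrite inE.
  apply/negP=> /rcosetP[y cy xE].
  by case/negP: s0_notin; rewrite -(mulKg y s0) -xE groupM ?groupV.
rewrite sumc -(sumc (fun g => F (g * s0)%g)) -rcosetE big_imset //.
by move=> x y _ _; apply: mulIg.
Qed.

Variables (rV : mx_representation algC W 2) (hV : is_reflection_repr m s0 s1 rV).

(** This is exp(2 i pi / m). *)
Definition zeta : algC := (m.-root (-1)) ^+ 2.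

Lemma zeta_prim : m.-primitive_root zeta.
Proof.
have dvd_m : (m %| m.*2)%N by rewrite -muln2 dvdn_mulr.
have := dvdn_prim_root (rootCN1_prim m1) dvd_m.
by rewrite -muln2 mulKn // ltnW.
Qed.

Let z : algC := m.-root (-1).
(** The rows are eigenvectors of the rotation c, exchanged by s0. *)
Let P : 'M[algC]_2 := \matrix_(i, j) (if j == 0 then if i == 0 then z^-1 else z else 1).
Let P' : 'M[algC]_2 := invmx P.

Let z0 : z != 0.
Proof. by rewrite (prim_root_eq0 (rootCN1_prim m1)) double_eq0 -lt0n ltnW. Qed.

Let detP : \det P = z^-1 - z.
Proof. by rewrite det2 !mxE /= mulr1 mul1r. Qed.

Let unitP : P \in unitmx.
Proof.
rewrite unitmxE unitfE detP subr_eq0; apply/eqP => zV.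
have : zeta ^+ 1 == 1 by rewrite expr1 /zeta expr2 -/z -[X in X * _]zV mulVf.
by rewrite -(prim_order_dvd zeta_prim) dvdn1; case: (m) m1 => [|[]].
Qed.

Let cosE : 2 * cos_pi_over m = z + z^-1.
Proof.
rewrite /cos_pi_over -/z ReE mulrC divfK ?pnatr_eq0 //; congr (_ + _).
have norm1 : `|z| = 1.
  have: `|z| ^+ m.*2 = 1.
    by rewrite -normrX (prim_expr_order (rootCN1_prim m1)) normr1.
  by move/eqP; rewrite pexpr_eq1 ?double_gt0 ?(ltnW m1) // => /eqP.
by rewrite invC_norm norm1 expr1n invr1 mul1r.
Qed.

Let Ps0 : P *m rV s0 = anti2 1 1 *m P.
Proof.
case: hV => -> _; apply/matrixP=> i j; rewrite !mxE !big_ord_recl !big_ord0 !mxE.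
case: i => [[|[|//]] lti]; case: j => [[|[|//]] ltj]; rewrite /I2_form /=
  ?mulrN ?opprK ?cosE ?(mulr1, mulr0, mul0r, addr0, add0r, mul1r, subr0); ring.
Qed.

Let Ps1 : P *m rV s1 = anti2 zeta^-1 zeta *m P.
Proof.
have zetaz : zeta * z^-1 = z by rewrite /zeta expr2 mulfK.
have zetaVz : zeta^-1 * z = z^-1 by rewrite -[X in _ * X]zetaz mulKf // expf_neq0.
case: hV => _ ->; apply/matrixP=> i j; rewrite !mxE !big_ord_recl !big_ord0 !mxE.
case: i => [[|[|//]] lti]; case: j => [[|[|//]] ltj]; rewrite /I2_form /=
  ?mulrN ?opprK ?cosE ?(mulr1, mulr0, mul0r, addr0, add0r, mul1r, subr0).
- by [].
- by rewrite opprK mulrDr mulVf // /zeta -/z expr2 invfM; ring.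
- by [].
- by rewrite opprK mulrDr mulfV // /zeta -/z expr2; ring.
Qed.

Let zeta0 : zeta != 0. Proof. exact: expf_neq0. Qed.

Definition rot a : 'M[algC]_2 := diag2 (zeta ^+ a) (zeta ^- a).
Definition refl a : 'M[algC]_2 := anti2 (zeta ^+ a) (zeta ^- a).

Let Prot a : P *m rV (c ^+ a)%g = rot a *m P.
Proof.
elim: a => [|a IHa].
  by rewrite expg0 repr_mx1 mulmx1 /rot expr0 invr1 diag2_1 mul1mx.
rewrite expgSr repr_mxM ?rotX_in ?(rotX_in 1) // mulmxA IHa -mulmxA.
rewrite /c repr_mxM ?s0_in ?s1_in // (mulmxA P) Ps0 -(mulmxA _ P) Ps1.
by rewrite !mulmxA -(mulmxA (rot a)) mul_anti2 mul_diag2 !mul1r /rot !exprSr (invfM (_ ^+ a)).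
Qed.

Let Prefl a : P *m rV (c ^+ a * s0)%g = refl a *m P.
Proof.
rewrite repr_mxM ?rotX_in ?s0_in // mulmxA Prot -mulmxA Ps0 mulmxA.
by rewrite mul_diag2_anti2 !mulr1.
Qed.

Let mxtrace_sim n (T A B : 'M[algC]_n) : T \in unitmx -> T *m A = B *m T -> \tr A = \tr B.
Proof.
by move=> uT TA; rewrite -[A](mulKmx uT) TA mulmxA mxtrace_mulC mulKVmx.
Qed.

Let sym_P_V n : sym_mx n P *m sym_mx n P' = 1%:M.
Proof. by rewrite -sym_mxM mulmxV // sym_mx1. Qed.

Let unit_sym_P n : sym_mx n P \in unitmx.
Proof. by case: (mulmx1_unit (sym_P_V n)). Qed.

Lemma sym_char_rot n a :
  sym_char rV n (c ^+ a)%g = \tr (sym_mx n (rot a)).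
Proof.
rewrite cfunE rotX_in mulr1n; apply: (mxtrace_sim (unit_sym_P n)).
by rewrite -!sym_mxM Prot.
Qed.

Lemma sym_char_refl n a :
  sym_char rV n (c ^+ a * s0)%g = (~~ odd n)%:R.
Proof.
rewrite cfunE groupM ?rotX_in ?s0_in // mulr1n.
rewrite -(tr_sym_anti2 n (mulfV (expf_neq0 a zeta0))).
by apply: (mxtrace_sim (unit_sym_P n)); rewrite -!sym_mxM Prefl.
Qed.

Lemma refl_char_rot a : cfRepr rV (c ^+ a)%g = zeta ^+ a + zeta ^- a.
Proof.
rewrite cfunE rotX_in mulr1n (mxtrace_sim unitP (Prot a)).
by rewrite /mxtrace !big_ord_recl big_ord0 !mxE /= !addr0.
Qed.

Lemma refl_char_refl a : cfRepr rV (c ^+ a * s0)%g = 0.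
Proof.
rewrite cfunE groupM ?rotX_in ?s0_in // mulr1n (mxtrace_sim unitP (Prefl a)).
by rewrite /mxtrace !big_ord_recl big_ord0 !mxE /= !addr0.
Qed.

Let det_sim (A B : 'M[algC]_2) : P *m A = B *m P -> \det A = \det B.
Proof.
by move=> PA; rewrite -[A](mulKmx unitP) PA !det_mulmx mulrA mulrAC -det_mulmx mulVmx ?det1 ?mul1r.
Qed.

Lemma sgn_rot a : detRepr rV (c ^+ a)%g = 1.
Proof.
rewrite cfunE rotX_in mulr1n /mxtrace big_ord1 mxE eqxx (det_sim (Prot a)) det2 !mxE /=.
by rewrite mulr0 subr0 mulfV ?expf_neq0.
Qed.

Lemma sgn_refl a : detRepr rV (c ^+ a * s0)%g = -1.
Proof.
rewrite cfunE groupM ?rotX_in ?s0_in // mulr1n /mxtrace big_ord1 mxE eqxx.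
by rewrite (det_sim (Prefl a)) det2 !mxE /= mulr0 sub0r mulfV ?expf_neq0.
Qed.

(** * Coinvariants *)

(** Right multiplication by [sym_mx n P'] gives the coordinates in the monomials
    x^(n-a) y^a, where x and y are the eigenvectors of the rotation that form
    the rows of [P]. *)
Let symP n := sym_mx n P.
Let symP' n := sym_mx n P'.

Let symPK n k (A : 'M_(k, n.+1)) : A *m symP n *m symP' n = A.
Proof. by rewrite -mulmxA /symP /symP' sym_P_V mulmx1. Qed.

Let symPKV n k (A : 'M_(k, n.+1)) : A *m symP' n *m symP n = A.
Proof. by rewrite -mulmxA (mulmx1C (sym_P_V n)) mulmx1. Qed.

Let sym_sim n (A B : 'M[algC]_2) : P *m A = B *m P ->
  sym_mx n A *m symP' n = symP' n *m sym_mx n B.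
Proof.
move=> PA; rewrite -[RHS]mulmx1 -(sym_P_V n) -/(symP n) -/(symP' n) !mulmxA.
congr (_ *m _); rewrite -mulmxA -sym_mxM -PA sym_mxM mulmxA.
by rewrite (mulmx1C (sym_P_V n)) mul1mx.
Qed.

Let mul_diag2_row n a b (w : 'rV[algC]_n.+1) j :
  (w *m sym_mx n (diag2 a b)) 0 j = w 0 j * (a ^+ (n - j) * b ^+ j).
Proof.
rewrite mxE (bigD1 j) //= big1 ?addr0 => [|i neq_ij]; rewrite sym_diag2 ?eqxx //.
by rewrite (negbTE neq_ij) mulr0.
Qed.

Let mul_anti2_row n a b (w : 'rV[algC]_n.+1) j :
  (w *m sym_mx n (anti2 a b)) 0 j = w 0 (rev_ord j) * (a ^+ j * b ^+ (n - j)).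
Proof.
rewrite mxE (bigD1 (rev_ord j)) //= big1 ?addr0 => [|i neq_ij]; rewrite sym_anti2.
  by rewrite eqxx /= subSS subKn ?leq_ord.
by rewrite (negbTE neq_ij) mulr0.
Qed.

(** The reflection s0 exchanges x^k and y^k; the rotation c multiplies x^k by the
    k-th power of [zeta], which is not 1 unless [m] divides [k]. *)
Let fix_coord k (f : 'rV[algC]_k.+1) (p := sym_sub k P' (rVpoly f)) :
    (f <= rfix_mx (sym_repr rV k) W)%MS ->
  p`_k = p`_0 /\ (~~ (m %| k)%N -> p`_0 = 0).
Proof.
move/rfix_mxP=> fixf; pose w := f *m symP' k.
have pE i : p`_(i : 'I_k.+1) = w 0 i by rewrite /p -rVpoly_sym_mx coef_rVpoly_ord.
have wc (g : gT) B : P *m rV g = B *m P -> g \in W -> w *m sym_mx k B = w.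
  by move=> PB Wg; rewrite -mulmxA -(sym_sim _ PB) mulmxA (fixf g Wg).
have fix_rot : w *m sym_mx k (rot 1) = w by apply: wc (Prot 1) (rotX_in 1).
have fix_refl : w *m sym_mx k (refl 0) = w.
  by apply: wc (Prefl 0) _; rewrite groupM ?rotX_in ?s0_in.
move: (pE ord_max) (pE ord0) => /= -> ->; clearbody w; clear wc pE p fixf; split.
  have := congr1 (fun w : 'rV_k.+1 => w 0 ord0) fix_refl.
  rewrite mul_anti2_row !expr0 subn0 invr1 expr1n !mulr1 => <-.
  by congr (w 0 _); apply: val_inj; rewrite /= subn1.
move=> ndvd; have := congr1 (fun w : 'rV_k.+1 => w 0 ord0) fix_rot.
rewrite mul_diag2_row subn0 expr0 mulr1 !expr1 => /eqP.
rewrite -subr_eq0 -[X in _ - X]mulr1 -mulrBr mulf_eq0 subr_eq0.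
by rewrite -(prim_order_dvd zeta_prim) (negbTE ndvd) orbF => /eqP.
Qed.

Let fix_monomials k (w : 'rV[algC]_k.+1) :
    (forall a, w *m sym_mx k (rot a) = w) -> (forall a, w *m sym_mx k (refl a) = w) ->
  (w *m symP k <= rfix_mx (sym_repr rV k) W)%MS.
Proof.
move=> w_rot w_refl; apply/rfix_mxP=> g /dihedralP[a [] ->].
  by rewrite -mulmxA -sym_mxM Prot sym_mxM mulmxA w_rot.
by rewrite -mulmxA -sym_mxM Prefl sym_mxM mulmxA w_refl.
Qed.

Lemma hilbert_ideal_mem n k (f : 'rV[algC]_k.+2) (h : {poly algC}) :
    (k < n)%N -> (size h <= n - k)%N -> (f <= rfix_mx (sym_repr rV k.+1) W)%MS ->
  (poly_rV (rVpoly f * h) <= hilbert_ideal rV n)%MS.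
Proof.
move=> lt_kn sh /submxP[D ->]; rewrite mulmx_sum_row linear_sum mulr_suml linear_sum /=.
apply: summx_sub => i _; rewrite linearZ /= -scalerAl linearZ /= scalemx_sub //.
have -> : h = \sum_(j < n - k) h`_j *: 'X^j.
  rewrite -poly_def; apply/polyP=> j; rewrite coef_poly; case: ltnP => // le_j.
  by rewrite nth_default // (leq_trans sh).
rewrite mulr_sumr linear_sum; apply: summx_sub => j _ /=.
rewrite -scalerAr linearZ scalemx_sub //.
apply: (sumsmx_sup (Ordinal lt_kn)) => //; apply: (sumsmx_sup i) => //.
by apply: (sumsmx_sup j) => //; rewrite genmxE.
Qed.

Let sym_imgM k l a b : (a <= k)%N -> (b <= l)%N ->
  sym_img k P a * sym_img l P b = sym_img (k + l) P (a + b).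
Proof.
move=> le_ak le_bl; rewrite /sym_img mulrACA -!exprD; congr (_ ^+ _ * _); lia.
Qed.

(** Such a monomial is a multiple of the invariant xy. *)
Let hilbert_mid n (a : 'I_n.+1) : (0 < a < n)%N -> (row a (symP n) <= hilbert_ideal rV n)%MS.
Proof.
case/andP=> a0 lt_an; have n2 : (1 < n)%N by apply: leq_ltn_trans lt_an.
pose w : 'rV[algC]_3 := delta_mx 0 (inord 1).
have wE (j : 'I_3) : w 0 j = (j == 1%N :> nat)%:R.
  by rewrite mxE eqxx -val_eqE /= inordK.
have inv : (w *m symP 2 <= rfix_mx (sym_repr rV 2) W)%MS.
  apply: fix_monomials => b; apply/rowP=> j.
    rewrite mul_diag2_row wE; case: eqP => [->|_]; rewrite ?mul0r //.
    by rewrite !expr1 mulfV ?mulr1 ?expf_neq0.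
  rewrite mul_anti2_row !wE /=; case: j => [[|[|[|//]]] ltj] /=; rewrite ?mul0r //.
  by rewrite !expr1 mulfV ?mulr1 ?expf_neq0.
have sh : (size (sym_img (n - 2) P a.-1) <= n - 1)%N.
  apply: leq_trans (size_sym_img _ _) _; first by rewrite -!subn1 leq_subLR addnBA // add1n; lia.
  by lia.
have wE2 : rVpoly (w *m symP 2) = sym_img 2 P 1.
  by rewrite -rowE rowK poly_rV_K ?size_sym_img // inordK.
have := hilbert_ideal_mem n2 sh inv; rewrite wE2 rowK sym_imgM //; last lia.
by rewrite subnKC // add1n prednK.
Qed.

(** The sum is a monomial times the invariant x^m + y^m. *)
Let hilbert_pair n (i j : 'I_n.+1) : (i + m = j)%N ->
  ((row i (symP n) + row j (symP n))%R <= hilbert_ideal rV n)%MS.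
Proof.
move=> ijm; have le_jn := leq_ord j; have le_mn : (m <= n)%N by lia.
have sh : (size (sym_img (n - m) P i) <= (n - m).+1)%N by apply: size_sym_img; lia.
have -> : row i (symP n) + row j (symP n) = poly_rV (sym_img n P i + sym_img n P j).
  by rewrite !rowK linearD.
have monoM a : (a <= m)%N ->
    sym_img n P (a + i) = sym_img m P a * sym_img (n - m) P i.
  by move=> le_am; rewrite sym_imgM ?subnKC //; lia.
rewrite -[in sym_img n P i](add0n i) -ijm (addnC i) !monoM // -mulrDl.
move: (sym_img (n - m) P i) sh => h sh {monoM i j ijm le_jn}.
have mE : m = m.-1.+1 by rewrite prednK // ltnW.
move: (m.-1) mE => k mE.
pose w : 'rV[algC]_k.+2 := delta_mx 0 ord0 + delta_mx 0 ord_max.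
have inv : (w *m symP k.+1 <= rfix_mx (sym_repr rV k.+1) W)%MS.
  have wE (j : 'I_k.+2) : w 0 j = (j == 0%N :> nat)%:R + (j == k.+1 :> nat)%:R.
    by rewrite !mxE !eqxx.
  have zm b : zeta ^+ b ^+ k.+1 = 1 by rewrite exprAC -mE (prim_expr_order zeta_prim) expr1n.
  apply: fix_monomials => b; apply/rowP=> j.
    rewrite mul_diag2_row wE; case: eqP => [->|_] /=.
      by rewrite subn0 expr0 zm !mulr1.
    case: eqP => [->|_]; last by rewrite addr0 mul0r.
    by rewrite subnn expr0 exprVn zm invr1 !mulr1.
  rewrite mul_anti2_row !wE /= subSS.
  case: eqP => [e|ne] /=.
    have -> : (j : nat) = k.+1 by have := leq_ord j; lia.
    by rewrite subnn expr0 zm eqxx addrC !mulr1.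
  case: eqP => [e|ne'] /=.
    have -> : (j : nat) = 0%N by have := leq_ord j; lia.
    by rewrite expr0 subn0 exprVn zm invr1 !mulr1 addrC.
  by rewrite addr0 mul0r; case: eqP => [?|?]; case: eqP => [?|?];
    rewrite ?addr0 //; have := leq_ord j; lia.
have lt_kn : (k < n)%N by rewrite -mE.
have {}sh : (size h <= n - k)%N by rewrite (leq_trans sh) // mE subnS prednK ?subn_gt0.
have := hilbert_ideal_mem lt_kn sh inv.
rewrite mulmxDl -!rowE linearD /= !rowK !poly_rV_K ?size_sym_img //.
by rewrite -mE.
Qed.
Let coef_top k l (p h : {poly algC}) : (size p <= k.+1)%N -> (size h <= l.+1)%N ->
  (p * h)`_(k + l) = p`_k * h`_l.
Proof.
move=> sp sh; have lt_k : (k < (k + l).+1)%N by rewrite ltnS leq_addr.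
rewrite coefM (bigD1 (Ordinal lt_k)) //= addKn big1 ?addr0 // => i neq_ik.
have [lt_ki|le_ik] := ltnP k i; first by rewrite nth_default ?mul0r // (leq_trans sp).
have lt_ik : (i < k)%N by rewrite ltn_neqAle le_ik andbT.
by rewrite [h`__]nth_default ?mulr0 // (leq_trans sh) //; lia.
Qed.

(** In the coordinates x^(n-a) y^a, a generator of the ideal is the product of
    an invariant of degree [k.+1] and a polynomial of degree [n - k.+1], so its
    extreme coefficients are the products of theirs. *)
Let hilbert_coord n (l : nat) (S : 'M[algC]_(n.+1, l)) :
    (forall w : 'rV[algC]_n.+1, w 0 ord_max = w 0 ord0 -> ((n < m)%N -> w 0 ord0 = 0) ->
       w *m S = 0) ->
  (n <= m)%N -> (hilbert_ideal rV n <= kermx (symP' n *m S))%MS.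
Proof.
move=> killS le_nm; apply/sumsmx_subP=> k _; apply/sumsmx_subP=> i _; apply/sumsmx_subP=> j _.
rewrite genmxE; apply/sub_kermxP; rewrite mulmxA.
set F := rVpoly (row i _); have lt_kn := ltn_ord k.
have [p_top p_0] := fix_coord (row_sub i (rfix_mx (sym_repr rV k.+1) W)).
set p := sym_sub _ _ _ in p_top p_0; set w := poly_rV _ *m _.
have sX : (size ('X^j : {poly algC}) <= (n - k.+1).+1)%N.
  by rewrite size_polyXn subnS prednK ?subn_gt0.
have sF : (size (F * 'X^j)%R <= n.+1)%N.
  have sF : (size F <= k.+2)%N by apply: size_poly.
  apply: leq_trans (size_polyMleq _ _) _; rewrite -subn1 leq_subLR add1n.
  by apply: leq_trans (leq_add sF sX) _; rewrite addSn addnS subnKC.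
pose h := sym_sub (n - k.+1) P' 'X^j.
have wE (a : 'I_n.+1) : w 0 a = (p * h)`_a.
  rewrite -coef_rVpoly_ord rVpoly_sym_mx poly_rV_K //.
  by rewrite -[X in sym_sub X](subnKC lt_kn) sym_subM // size_poly.
have w_0 : w 0 ord0 = p`_0 * h`_0 by rewrite wE coef0M.
have w_top : w 0 ord_max = p`_k.+1 * h`_(n - k.+1).
  by rewrite wE /= -{1}(subnKC lt_kn) coef_top ?size_sym_sub.
have [/eqP km|ndvd] := boolP (k.+1 == m).
  have nm : n = m by apply/eqP; rewrite eqn_leq le_nm -km.
  apply: killS; last by move/leq_trans/(_ (eq_leq (esym nm))); rewrite ltnn.
  have nk0 : (n - k.+1)%N = 0%N by apply/eqP; rewrite subn_eq0 km.
  by rewrite w_0 w_top p_top nk0.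
have {}p_0 : p`_0 = 0.
  by apply: p_0; apply: contra ndvd => /dvdn_leq; lia.
by apply: killS; rewrite w_0 ?w_top ?p_top p_0 !mul0r.
Qed.

Let hilbert_ker n l (S : 'M[algC]_(n.+1, l)) :
    (forall w : 'rV[algC]_n.+1, w *m S = 0 ->
       (w *m symP n <= hilbert_ideal rV n)%MS) ->
  (kermx (symP' n *m S) <= hilbert_ideal rV n)%MS.
Proof.
move=> kerS; apply/rV_subP=> v /sub_kermxP; rewrite mulmxA => /kerS.
by rewrite symPKV.
Qed.

Let coinv_trace n l (S : 'M[algC]_(n.+1, l)) (u : 'M[algC]_(l, n.+1))
    (B : 'M[algC]_2) (M : 'M[algC]_l) g :
    g \in W -> (hilbert_ideal rV n :=: kermx (symP' n *m S))%MS ->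
    u *m S = 1%:M -> P *m rV g = B *m P -> sym_mx n B *m S = S *m M ->
  coinv_char rV n g = \tr M.
Proof.
move=> Wg hilbE uS PB SM; rewrite cfunE Wg mulr1n.
apply: (mxtrace_factmod (u := u *m symP n) _ Wg _ hilbE).
  by rewrite !mulmxA symPK.
by rewrite mulmxA [sym_repr _ _ _]/(sym_mx n (rV g)) (sym_sim n PB) -!mulmxA SM.
Qed.

Lemma coinv_char0 : coinv_char rV 0 = 1.
Proof.
apply/cfun_inP=> g Wg; rewrite cfun1E Wg.
have hilb0 : (hilbert_ideal rV 0 :=: kermx (symP' 0 *m 1%:M))%MS.
  rewrite mulmx1 /hilbert_ideal big_ord0; apply: eqmx_sym; apply/eqmxP.
  rewrite sub0mx andbT submx0 kermx_eq0 row_free_unit.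
  by have /mulmx1C/mulmx1_unit[] := sym_P_V 0.
have mx0 (A : 'M[algC]_2) : sym_mx 0 A = 1%:M.
  apply/matrixP=> i j; rewrite !ord1 !mxE /sym_img !expr0 mulr1 coefC eqxx.
  by [].
have [B PB] : exists B, P *m rV g = B *m P.
  by case/dihedralP: Wg => a [] ->; [exists (rot a) | exists (refl a)].
rewrite (coinv_trace Wg hilb0 (mul1mx _) PB (M := 1%:M)) ?mxtrace1 //.
by rewrite mx0.
Qed.

(** Above degree m nothing is left, because
    x^n = (x^m + y^m) x^(n-m) - x^(n-m) y^m. *)
Lemma coinv_char_big n : (m < n)%N -> coinv_char rV n = 0.
Proof.
move=> lt_mn; apply/cfun_inP=> g Wg; rewrite [RHS]cfunE.
have hilbE : (hilbert_ideal rV n :=: kermx (symP' n *m (0 : 'M[algC]_(_, 0))))%MS.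
  apply/eqmxP/andP; split.
    by apply/sub_kermxP; rewrite !mulmx0.
  apply: hilbert_ker => w _; rewrite mulmx_sum_row; apply: summx_sub => a _.
  rewrite scalemx_sub //; have [a0|a0] := posnP a.
    have lt_m : (m < n.+1)%N by rewrite ltnS ltnW.
    rewrite (_ : a = ord0); last exact: val_inj.
    rewrite -[row _ _](addrK (row (Ordinal lt_m) (symP n))) addmx_sub //.
      exact: hilbert_pair.
    by rewrite eqmx_opp hilbert_mid //= ltnW.
  have [an|an] := ltnP a n; first by apply: hilbert_mid; rewrite a0.
  have lt_m : (n - m < n.+1)%N by rewrite ltnS leq_subr.
  rewrite -[row _ _](addrK (row (Ordinal lt_m) (symP n))) addmx_sub //.
    by rewrite addrC; apply: hilbert_pair => /=; have := leq_ord a; lia.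
  by rewrite eqmx_opp hilbert_mid //=; lia.
have [B PB] : exists B, P *m rV g = B *m P.
  by case/dihedralP: Wg => a [] ->; [exists (rot a) | exists (refl a)].
rewrite (coinv_trace (u := 0) Wg hilbE _ PB (M := 0)) ?mxtrace0 ?mulmx0 //.
by apply/matrixP; case.
Qed.

(** In these degrees the ideal is spanned by the multiples of xy, so the
    coefficients at x^n and y^n identify the quotient. *)
Section Middle.

Variable n : nat.
Hypothesis (n0 : (0 < n)%N) (lt_nm : (n < m)%N).

Let S : 'M[algC]_(n.+1, 2) := \matrix_(i, j) (i == (if j == 0 then ord0 else ord_max))%:R.

Let S_row (w : 'rV_n.+1) j : (w *m S) 0 j = w 0 (if j == 0 then ord0 else ord_max).
Proof.
set k := (X in w 0 X); rewrite mxE (bigD1 k) //= mxE eqxx mulr1 big1 ?addr0 // => i /negbTE ik.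
by rewrite mxE ik mulr0.
Qed.

Let S_mul l (A : 'M_(l, n.+1)) i j : (A *m S) i j = A i (if j == 0 then ord0 else ord_max).
Proof.
by have := S_row (row i A) j; rewrite -row_mul mxE [in RHS]mxE.
Qed.

Let trS : S^T *m S = 1%:M.
Proof.
apply/matrixP=> i j; rewrite S_mul !mxE.
have n1 : (ord0 == ord_max :> 'I_n.+1) = false by rewrite -val_eqE /= ltn_eqF.
by case: i => [[|[|//]] lti]; case: j => [[|[|//]] ltj] /=; rewrite ?eqxx // ?n1 // eq_sym n1.
Qed.

Let hilbE : (hilbert_ideal rV n :=: kermx (symP' n *m S))%MS.
Proof.
apply/eqmxP/andP; split.
  apply: hilbert_coord; last exact: ltnW.
  move=> w wn w0; apply/rowP=> j; rewrite S_row mxE.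
  by case: ifP => _; rewrite ?wn w0.
apply: hilbert_ker => w wS; rewrite mulmx_sum_row; apply: summx_sub => a _.
have w0 : w 0 ord0 = 0 by have := congr1 (fun w : 'rV_2 => w 0 0) wS; rewrite S_row mxE.
have wn : w 0 ord_max = 0 by have := congr1 (fun w : 'rV_2 => w 0 1) wS; rewrite S_row mxE.
have [a0|a0] := posnP a; first by rewrite (_ : a = ord0) ?w0 ?scale0r ?sub0mx //; exact: val_inj.
have [an|an] := ltnP a n; first by rewrite scalemx_sub // hilbert_mid ?a0.
rewrite (_ : a = ord_max) ?wn ?scale0r ?sub0mx //; apply: val_inj; apply/eqP.
by rewrite eqn_leq an leq_ord.
Qed.

Lemma coinv_char_mid_rot a : coinv_char rV n (c ^+ a)%g = zeta ^+ a ^+ n + zeta ^- a ^+ n.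
Proof.
have SM : sym_mx n (rot a) *m S = S *m diag2 (zeta ^+ a ^+ n) (zeta ^- a ^+ n).
  apply/matrixP=> i j; rewrite S_mul sym_diag2 !mxE !big_ord_recl big_ord0 !mxE.
  case: j => [[|[|//]] ltj] /=; case: eqP => [-> | _];
    by rewrite ?(mul1r, mul0r, addr0, add0r, mulr0, subn0, subnn, expr0, mulr1).
rewrite (coinv_trace (rotX_in a) hilbE trS (Prot a) SM).
by rewrite /mxtrace !big_ord_recl big_ord0 !mxE addr0.
Qed.

Lemma coinv_char_mid_refl a : coinv_char rV n (c ^+ a * s0)%g = 0.
Proof.
have SM : sym_mx n (refl a) *m S = S *m anti2 (zeta ^+ a ^+ n) (zeta ^- a ^+ n).
  apply/matrixP=> i j; rewrite S_mul sym_anti2 !mxE !big_ord_recl big_ord0 !mxE.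
  have r0 : rev_ord ord0 = ord_max :> 'I_n.+1 by apply: val_inj; rewrite /= subn1.
  have rm : rev_ord ord_max = ord0 :> 'I_n.+1 by apply: val_inj; rewrite /= subnn.
  case: j => [[|[|//]] ltj] /=; rewrite ?r0 ?rm; case: eqP => [-> | _];
    by rewrite ?(mul1r, mul0r, addr0, add0r, mulr0, subn0, subnn, expr0, mulr1).
have Wg : (c ^+ a * s0)%g \in W by rewrite groupM ?rotX_in ?s0_in.
rewrite (coinv_trace Wg hilbE trS (Prefl a) SM).
by rewrite /mxtrace !big_ord_recl big_ord0 !mxE /= !addr0.
Qed.

End Middle.

(** In degree m the relation x^m = - y^m is added, and the difference of the
    two extreme coefficients identifies the quotient. *)
Lemma coinv_top_projection : exists S : 'M[algC]_(m.+1, 1),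
  [/\ (hilbert_ideal rV m :=: kermx (symP' m *m S))%MS, delta_mx 0 ord0 *m S = 1%:M,
      forall a, sym_mx m (rot a) *m S = S *m 1%:M
    & forall a, sym_mx m (refl a) *m S = S *m (-1)%:M].
Proof.
have m0 : (0 < m)%N := ltnW m1.
have zm b : zeta ^+ b ^+ m = 1 by rewrite exprAC (prim_expr_order zeta_prim) expr1n.
have n0m : (ord0 == ord_max :> 'I_m.+1) = false by rewrite -val_eqE /= ltn_eqF.
have nm0 : (ord_max == ord0 :> 'I_m.+1) = false by rewrite eq_sym.
pose S : 'M[algC]_(m.+1, 1) := delta_mx ord0 0 - delta_mx ord_max 0.
have SE l (A : 'M[algC]_(l, m.+1)) i j : (A *m S) i j = A i ord0 - A i ord_max.
  by rewrite mulmxBr -!colE !mxE.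
exists S; split.
- apply/eqmxP/andP; split.
    apply: hilbert_coord => // w w0 _; apply/rowP=> j.
    by rewrite SE w0 subrr mxE.
  apply: hilbert_ker => w wS.
  have {wS} w0 : w 0 ord_max = w 0 ord0.
    have := congr1 (fun w : 'rV_1 => w 0 0) wS; rewrite SE mxE => /eqP.
    by rewrite subr_eq0 => /eqP.
  rewrite mulmx_sum_row (bigD1 ord0) //= (bigD1 ord_max) ?nm0 //= w0 addrA -scalerDr.
  rewrite addmx_sub ?scalemx_sub ?hilbert_pair //.
  apply: summx_sub => a /andP[a0 am]; rewrite scalemx_sub // hilbert_mid //.
  by rewrite lt0n a0 ltn_neqAle am leq_ord.
- by apply/matrixP=> i j; rewrite !ord1 SE !mxE nm0 subr0 eqxx.
- move=> a; rewrite mulmx1; apply/matrixP=> i j; rewrite !ord1 SE !sym_diag2 !mxE !andbT.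
  case: eqP => [->|_]; first by rewrite n0m /= subn0 expr0 zm mulr1.
  case: eqP => [->|_] //; by rewrite subnn expr0 exprVn zm invr1 mulr1.
move=> a; rewrite mul_mx_scalar scaleN1r; apply/matrixP=> i j.
rewrite !ord1 SE !sym_anti2 !mxE !andbT.
have r0 : rev_ord ord0 = ord_max :> 'I_m.+1 by apply: val_inj; rewrite /= subn1.
have rm : rev_ord ord_max = ord0 :> 'I_m.+1 by apply: val_inj; rewrite /= subnn.
rewrite r0 rm opprB.
case: eqP => [->|_]; first by rewrite nm0 /= subnn expr0 exprVn zm invr1 mulr1.
by case: eqP => [->|_] //; rewrite subn0 expr0 zm mulr1.
Qed.

Lemma coinv_char_top_rot a : coinv_char rV m (c ^+ a)%g = 1.
Proof.
have [S [hilbE uS SM _]] := coinv_top_projection.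
by rewrite (coinv_trace (rotX_in a) hilbE uS (Prot a) (SM a)) mxtrace1.
Qed.

Lemma coinv_char_top_refl a : coinv_char rV m (c ^+ a * s0)%g = -1.
Proof.
have [S [hilbE uS _ SM]] := coinv_top_projection.
have Wg : (c ^+ a * s0)%g \in W by rewrite groupM ?rotX_in ?s0_in.
by rewrite (coinv_trace Wg hilbE uS (Prefl a) (SM a)) mxtrace_scalar.
Qed.

End Dihedral.

(** * Characters of the dihedral group *)

Section Chebyshev.

Variables (R : comNzRingType) (e v : R).

(** The class functions that take the value al^n + al^-n at a rotation with
    eigenvalues al and al^-1, and 0 at reflections, when [v] is the reflection
    character and [e] its determinant. *)
Fixpoint cheb (n : nat) : R :=
  if n is n1.+1 then if n1 is n2.+1 then v * cheb n1 - cheb n2 else v else 1 + e.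

Lemma chebSS n : cheb n.+2 = v * cheb n.+1 - cheb n.
Proof. by []. Qed.

Hypotheses (ee : e * e = 1) (ev : e * v = v).

Lemma mul_sgn_cheb n : e * cheb n = cheb n.
Proof.
suff: e * cheb n = cheb n /\ e * cheb n.+1 = cheb n.+1 by case.
elim: n => [|n [IH1 IH2]]; first by rewrite /= mulrDr ee mulr1 addrC.
by split=> //; rewrite chebSS mulrBr IH1 mulrCA IH2.
Qed.

(** The Chebyshev recurrence makes this product telescope. *)
Lemma koszul_cheb x b :
  (1 - v * x + e * x ^+ 2) * (\sum_(n < b.+1) cheb n * x ^+ n - e)
    = 1 - x ^+ 2 - cheb b.+1 * x ^+ b.+1 + cheb b * x ^+ b.+2.
Proof.
elim: b => [|b IHb].
  by rewrite big_ord1 /=; ring.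
rewrite big_ord_recr /= [X in _ * X]addrAC mulrDr IHb -/(cheb b.+1) -/(cheb b.+2).
have vE : v * cheb b.+1 = cheb b.+2 + cheb b by rewrite chebSS subrK.
have -> : (1 - v * x + e * x ^+ 2) * (cheb b.+1 * x ^+ b.+1) =
    cheb b.+1 * x ^+ b.+1 - (v * cheb b.+1) * x ^+ b.+2 + (e * cheb b.+1) * x ^+ b.+3.
  by rewrite !exprS; ring.
by rewrite vE mul_sgn_cheb; ring.
Qed.

End Chebyshev.

Section DihedralCharacters.

Variables (m : nat) (gT : finGroupType) (W : {group gT}) (s0 s1 : gT).
Hypotheses (m1 : (1 < m)%N) (hW : I2_system m W s0 s1).
Variables (rV : mx_representation algC W 2) (hV : is_reflection_repr m s0 s1 rV).

Local Notation c := (s0 * s1)%g.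
Local Notation V := (cfRepr rV).
Local Notation e := (detRepr rV).

(** [dih n] is the character induced from the n-th power of the character
    zeta of the rotation subgroup. *)
Definition dih n : 'CF(W) := cheb e V n.

Lemma eq_dihedral (phi psi : 'CF(W)) :
    (forall a, phi (c ^+ a)%g = psi (c ^+ a)%g) ->
    (forall a, phi (c ^+ a * s0)%g = psi (c ^+ a * s0)%g) ->
  phi = psi.
Proof.
by move=> eq_rot eq_refl; apply/cfun_inP=> g /(dihedralP m1 hW)[a [] ->].
Qed.

Let rotW a : (c ^+ a)%g \in W. Proof. exact: rotX_in hW a. Qed.
Let reflW a : (c ^+ a * s0)%g \in W. Proof. by rewrite groupM ?rotW ?(s0_in hW). Qed.
Let V_rot := refl_char_rot m1 hW hV.
Let V_refl := refl_char_refl m1 hW hV.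
Let e_rot := sgn_rot m1 hW hV.
Let e_refl := sgn_refl m1 hW hV.
Let S_rot := sym_char_rot m1 hW hV.
Let S_refl := sym_char_refl m1 hW hV.

Let addE (phi psi : 'CF(W)) g : (phi + psi) g = phi g + psi g. Proof. by rewrite cfunE. Qed.
Let subE (phi psi : 'CF(W)) g : (phi - psi) g = phi g - psi g. Proof. by rewrite !cfunE. Qed.
Let mulE (phi psi : 'CF(W)) g : (phi * psi) g = phi g * psi g. Proof. by rewrite cfunE. Qed.

Let zeta0 : zeta m != 0.
Proof. by rewrite (prim_root_eq0 (zeta_prim m1)) -lt0n ltnW. Qed.

Lemma dih_rot n a : dih n (c ^+ a)%g = zeta m ^+ a ^+ n + zeta m ^- a ^+ n.
Proof.
suff: dih n (c ^+ a)%g = zeta m ^+ a ^+ n + zeta m ^- a ^+ n /\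
      dih n.+1 (c ^+ a)%g = zeta m ^+ a ^+ n.+1 + zeta m ^- a ^+ n.+1 by case.
elim: n => [|n [IH1 IH2]].
  rewrite /dih /= addE cfun1E rotW e_rot V_rot.
  by rewrite !expr0 !expr1.
split=> //; rewrite /dih chebSS subE mulE -/(dih _) -/(dih _) IH1 IH2 V_rot.
set al := zeta m ^+ a; have al0 : al != 0 by apply: expf_neq0.
by rewrite !exprS !(mulrDl, mulrDr) !mulrA mulVf // mulfV // !mul1r; ring.
Qed.

Lemma dih_refl n a : dih n (c ^+ a * s0)%g = 0.
Proof.
suff: dih n (c ^+ a * s0)%g = 0 /\ dih n.+1 (c ^+ a * s0)%g = 0 by case.
elim: n => [|n [IH1 IH2]].
  rewrite /dih /= addE cfun1E reflW.
  by rewrite e_refl V_refl subrr.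
by split=> //; rewrite /dih chebSS subE mulE -/(dih _) -/(dih _) IH1 IH2 mulr0 subr0.
Qed.

Lemma sgn_sgn : e * e = 1.
Proof.
apply: eq_dihedral => a; rewrite mulE cfun1E.
  by rewrite e_rot rotW mulr1.
by rewrite e_refl reflW mulrNN mulr1.
Qed.

Lemma sgn_V : e * V = V.
Proof.
apply: eq_dihedral => a; rewrite mulE.
  by rewrite e_rot mul1r.
by rewrite V_refl mulr0.
Qed.

Lemma sgn_dih n : e * dih n = dih n.
Proof. exact: mul_sgn_cheb sgn_sgn sgn_V n. Qed.

Let zm a : zeta m ^+ a ^+ m = 1.
Proof. by rewrite exprAC (prim_expr_order (zeta_prim m1)) expr1n. Qed.

Lemma dih_periodic n : dih (n + m) = dih n.
Proof.
apply: eq_dihedral => a; rewrite ?dih_refl // !dih_rot !exprD.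
by rewrite [in X in _ + X]exprVn !(exprVn, zm, invr1, mulr1).
Qed.

Let expB (a b : algC) n k : a * b = 1 -> (k <= n)%N -> a ^+ n * b ^+ k = a ^+ (n - k).
Proof.
by move=> ab le_kn; rewrite -{1}(subnK le_kn) exprD -mulrA -exprMn ab expr1n mulr1.
Qed.

Let alV a : zeta m ^+ a * zeta m ^- a = 1.
Proof. by rewrite mulfV // expf_neq0. Qed.

Lemma dih_sym n : (n <= m)%N -> dih (m - n) = dih n.
Proof.
move=> le_nm; apply: eq_dihedral => a; rewrite ?dih_refl // !dih_rot.
rewrite -(expB (alV a) le_nm) -(expB (etrans (mulrC _ _) (alV a)) le_nm).
by rewrite zm [_^-1 ^+ m]exprVn zm invr1 !mul1r addrC.
Qed.

Lemma dih_mul n k : (k <= n)%N -> dih n * dih k = dih (n + k) + dih (n - k).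
Proof.
move=> le_kn; apply: eq_dihedral => a; rewrite mulE addE ?dih_refl ?mulr0 ?addr0 // !dih_rot.
rewrite -(expB (alV a) le_kn) -(expB (etrans (mulrC _ _) (alV a)) le_kn) !exprD.
by rewrite mulrDl !mulrDr addrACA addrC [X in _ + X]addrC addrA; ring.
Qed.

Lemma coinv_dih n : (0 < n < m)%N -> coinv_char rV n = dih n.
Proof.
case/andP=> n0 lt_nm; apply: eq_dihedral => a.
  by rewrite dih_rot (coinv_char_mid_rot m1 hW hV).
by rewrite dih_refl (coinv_char_mid_refl m1 hW hV).
Qed.

Lemma coinv_top : coinv_char rV m = e.
Proof.
apply: eq_dihedral => a.
  by rewrite e_rot (coinv_char_top_rot m1 hW hV).
by rewrite e_refl (coinv_char_top_refl m1 hW hV).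
Qed.

Lemma sym_char0 : sym_char rV 0 = 1.
Proof.
apply: eq_dihedral => a; rewrite cfun1E.
  by rewrite S_rot tr_sym_diag2 big_ord1 !expr0 mulr1 rotW.
by rewrite S_refl reflW.
Qed.

Lemma sym_char1 : sym_char rV 1 = V.
Proof.
apply: eq_dihedral => a.
  rewrite S_rot V_rot tr_sym_diag2 !big_ord_recl big_ord0 /=.
  by rewrite !expr0 !expr1 mulr1 mul1r addr0.
by rewrite S_refl V_refl.
Qed.

Lemma sym_charSS n : sym_char rV n.+2 = sym_char rV n + dih n.+2.
Proof.
apply: eq_dihedral => a; rewrite addE.
  rewrite dih_rot !S_rot tr_sym_diag2_rec ?alV //.
by rewrite dih_refl !S_refl /= negbK addr0.
Qed.

Let sum_unity (w : algC) : w ^+ m = 1 -> \sum_(a < m) w ^+ a = if w == 1 then m%:R else 0.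
Proof.
move=> wm; case: eqP => [->|/eqP w1].
  under eq_bigr do rewrite expr1n.
  by rewrite sumr_const card_ord.
have : (w - 1) * (\sum_(a < m) w ^+ a) = 0 by rewrite -subrX1 wm subrr.
by move/eqP; rewrite mulf_eq0 subr_eq0 (negbTE w1) => /eqP.
Qed.

Let oW : #|W|%:R = m%:R *+ 2 :> algC.
Proof. by case: hW => _ _ _ _ ->; rewrite -mul2n natrM mulr_natl. Qed.

Let mR0 : m%:R != 0 :> algC.
Proof. by rewrite pnatr_eq0 -lt0n ltnW. Qed.

Lemma cfdot_dih_1 n : '[dih n, 1] = (m %| n)%:R.
Proof.
rewrite cfdotE (sum_dihedral m1 hW) [X in _ + X]big1 ?addr0; last first.
  by move=> a _; rewrite dih_refl mul0r.
under eq_bigr => a _.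
  rewrite dih_rot cfun1E rotW conjC1 mulr1 -exprVn exprAC [X in _ + X]exprAC.
  over.
rewrite big_split /= !sum_unity; last first.
- by rewrite exprAC (prim_expr_order (zeta_prim m1)) expr1n.
- by rewrite exprAC exprVn (prim_expr_order (zeta_prim m1)) invr1 expr1n.
rewrite exprVn invr_eq1 -(prim_order_dvd (zeta_prim m1)) oW.
case: (m %| n)%N; last by rewrite addr0 mulr0.
by rewrite -mulr2n mulVf // mulrn_eq0.
Qed.

(** The values of [dih k] are real, so this follows from [dih_mul]. *)
Lemma cfdot_dih n k : (k <= n)%N -> '[dih n, dih k] = (m %| n + k)%:R + (m %| n - k)%:R.
Proof.
move=> le_kn; rewrite -!cfdot_dih_1 -cfdotDl -dih_mul // !cfdotE; congr (_ * _).
apply: eq_bigr => g Wg; rewrite mulE cfun1E Wg conjC1 mulr1; congr (_ * _).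
have zn : `|zeta m| = 1.
  have: `|zeta m| ^+ m = 1 by rewrite -normrX (prim_expr_order (zeta_prim m1)) normr1.
  by move/eqP; rewrite pexpr_eq1 ?(ltnW m1) // => /eqP.
have zV : (zeta m)^* = (zeta m)^-1 by rewrite invC_norm zn expr1n invr1 mul1r.
have [a [] ->] := dihedralP m1 hW Wg; last by rewrite dih_refl conjC0.
rewrite dih_rot; move: (zeta m) zV => w wV.
by rewrite rmorphD !rmorphXn fmorphV !rmorphXn /= wV !exprVn !invrK addrC.
Qed.

(** At a nontrivial rotation the sum of the al^n over n < m vanishes.  It follows
    that every irreducible character occurs in the coinvariant algebra. *)
Lemma sum_coinv : \sum_(n < m.+1) coinv_char rV n = cfReg W.
Proof.
have m0 : (0 < m)%N := ltnW m1.
have -> : \sum_(n < m.+1) coinv_char rV n = \sum_(n < m) dih n.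
  rewrite big_ord_recr /= coinv_top -(prednK m0) !big_ord_recl /= (coinv_char0 m1 hW hV).
  rewrite addrAC; congr (_ + _); apply: eq_bigr => i _; rewrite coinv_dih //=.
  by have := ltn_ord i; rewrite /bump /=; lia.
have sumE g : (\sum_(n < m) dih n) g = \sum_(n < m) dih n g by rewrite sum_cfunE.
apply: eq_dihedral => a; rewrite sumE cfRegE.
  under eq_bigr do rewrite dih_rot.
  rewrite big_split /= !sum_unity ?exprVn ?zm ?invr1 // invr_eq1.
  rewrite -(prim_order_dvd (zeta_prim m1)) -order_dvdn.
  have -> : #[c]%g = m by case: hW.
  by case: ifP => _; rewrite ?addr0 // oW mulr2n.
rewrite big1 => [|n _]; last by rewrite dih_refl.
case: eqP => // c1; have := e_refl a; rewrite c1 -(expg0 c) e_rot => /eqP.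
by rewrite -subr_eq0 opprK -(natrD _ 1 1) pnatr_eq0.
Qed.

Local Notation C := (coinv_char rV).
Local Notation S := (sym_char rV).

Lemma coinv_is_char n : C n \is a character. Proof. exact: cfRepr_char. Qed.

Let cfdot_natP (phi : 'CF(W)) i : phi \is a character -> 0 <= '[phi, 'chi_i].
Proof. by move=> chi; rewrite natr_ge0 // Cnat_cfdot_char_irr. Qed.

Let ex_coinv i : exists n, '[C n, 'chi_i] != 0.
Proof.
have : '[cfReg W, 'chi_i] != 0.
  rewrite cfReg_sum cfdot_suml (bigD1 i) //= cfdotZl cfdot_irr eqxx mulr1 big1 ?addr0 ?irr1_neq0 //.
  by move=> j ji; rewrite cfdotZl cfdot_irr (negbTE ji) mulr0.
rewrite -sum_coinv cfdot_suml => nz.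
have [/existsP[n Cn]|] := boolP [exists n : 'I_m.+1, '[C n, 'chi_i] != 0]; first by exists n.
rewrite negb_exists => /forallP h; case/negP: nz; apply/eqP/big1 => n _.
by have := h n; rewrite negbK => /eqP.
Qed.

Let sym_below i d : (forall n, (n < d)%N -> '[C n, 'chi_i] = 0) -> (d <= m)%N ->
  forall n, (n < d)%N -> '[S n, 'chi_i] = 0.
Proof.
move=> Cd le_dm; elim/ltn_ind => -[|[|n]] IHn lt_nd.
- by rewrite sym_char0 -(coinv_char0 m1 hW hV) Cd.
- by rewrite sym_char1 -[V]/(dih 1) -coinv_dih ?Cd // m1.
rewrite sym_charSS cfdotDl IHn ?add0r; [|lia|lia].
by rewrite -coinv_dih ?Cd //; lia.
Qed.

(** The least degree in which an irreducible character occurs is the same for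
    the symmetric and for the coinvariant algebra, because S_n - S_(n-2) = [dih n]
    is C_n for 0 < n < m and C_m + 1 for n = m. *)
Lemma fake_degreeP i (b := fake_degree rV i) :
  [/\ (b <= m)%N, '[C b, 'chi_i] != 0 & forall n, (n < b)%N -> '[C n, 'chi_i] = 0].
Proof.
have [d Cd d_min] := ex_minnP (ex_coinv i).
have {}d_min n : (n < d)%N -> '[C n, 'chi_i] = 0.
  by move=> lt_nd; apply: contraTeq lt_nd => /d_min; rewrite -leqNgt.
have le_dm : (d <= m)%N.
  by rewrite leqNgt; apply: contra Cd => lt_md; rewrite (coinv_char_big m1 hW hV) ?cfdot0l.
have S0 := sym_below d_min le_dm.
have Sd : '[S d, 'chi_i] != 0.
  case: d Cd d_min le_dm S0 => [|[|d]] Cd d_min le_dm S0.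
  - by rewrite sym_char0 -(coinv_char0 m1 hW hV).
  - by rewrite sym_char1 -[V]/(dih 1) -coinv_dih // m1.
  rewrite sym_charSS cfdotDl S0 ?add0r; last lia.
  move: le_dm; rewrite leq_eqVlt => /orP[/eqP dm|lt_dm]; last by rewrite -coinv_dih.
  rewrite dm -[m]add0n dih_periodic [dih 0]/(1 + e) cfdotDl.
  move: Cd; rewrite dm coinv_top; apply: contraNneq => /eqP.
  rewrite paddr_eq0 ?cfdot_natP ?rpred1 ?cfRepr_char //; by case/andP.
suff -> : b = d by [].
rewrite /b /fake_degree; apply: classical_sets.xget_unique => [|n []].
  split; first by rewrite irr_consttE.
  by move=> n; rewrite irr_consttE leqNgt; apply: contra => /S0 ->.
rewrite irr_consttE => Sn n_min; apply/eqP; rewrite eqn_leq n_min ?irr_consttE //=.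
by rewrite leqNgt; apply: contra Sn => /S0 ->.
Qed.

Let dvd_small n : (0 < n < m)%N -> (m %| n)%N = false.
Proof. by case/andP=> n0 lt_nm; rewrite gtnNdvd. Qed.

Lemma irr_of_norm1 (phi : 'CF(W)) i : phi \is a character -> '[phi] = 1 ->
  '[phi, 'chi_i] != 0 -> 'chi_i = phi.
Proof.
move=> chphi /eqP n1 nz; have /irrP[j phiE] : phi \in irr W by rewrite irrEchar chphi.
by move: nz; rewrite phiE cfdot_irr pnatr_eq0 eqb0 negbK => /eqP->.
Qed.

Lemma sgn_norm : '[e] = 1.
Proof.
have : e \is a linear_char by exact: detRepr_lin_char.
by move/lin_char_irr/irrP=> [j ->]; rewrite cfdot_irr eqxx.
Qed.

Lemma cfdot_sgn (phi psi : 'CF(W)) : '[e * phi, e * psi] = '[phi, psi].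
Proof.
rewrite !cfdotE; congr (_ * _); apply: eq_bigr => g Wg.
rewrite !mulE rmorphM mulrACA; have [a [] ->] := dihedralP m1 hW Wg.
  by rewrite e_rot rmorph1 !mul1r.
by rewrite e_refl rmorphN rmorph1 mulrNN !mul1r.
Qed.

Let char1_nat (phi : 'CF(W)) : phi \is a character -> exists k : nat, phi 1%g = k%:R.
Proof. by move/Cnat_char1/natrP. Qed.

(** A constituent of degree 2 would exhaust [dih b], which has norm 2.  So 'chi_i
    is linear, does not vanish at reflections, and differs from its product with
    the sign, which is a constituent too; together they have degree 2. *)
Let split_dih b i : b.*2 = m -> dih b \is a character -> '[dih b] = 2 ->
  '[dih b, 'chi_i] != 0 -> 'chi_i + e * 'chi_i = dih b /\ '[dih b, 'chi_i] = 1.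
Proof.
move=> b2m chb nb2 nz; have i_constt : i \in irr_constt (dih b) by rewrite irr_consttE.
have dih1 : dih b 1%g = 2 by rewrite -(expg0 c) dih_rot !expr0 invr1 !expr1n -(natrD _ 1 1).
have [chi' ch' dihE] := constt_charP i chb i_constt.
have [k' ek'] := char1_nat ch'; have [k ek] := char1_nat (irr_char i).
have k_gt0 : (0 < k)%N by have := irr1_gt0 i; rewrite ek ltr0n.
have kk' : (k + k' = 2)%N.
  by apply/eqP; rewrite -(@eqr_nat algC) natrD -ek -ek' -addE -dihE dih1.
have k'_gt0 : (0 < k')%N.
  rewrite lt0n; apply/eqP => k'0; have /eqP : chi' 1%g = 0 by rewrite ek' k'0.
  rewrite char1_eq0 // => /eqP chi'0; move: nb2.
  by rewrite dihE chi'0 addr0 cfnorm_irr => /eqP; rewrite eq_sym (eqr_nat _ 2 1).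
have {}ek : 'chi_i 1%g = 1 by rewrite ek (_ : k = 1%N) //; lia.
have {}ek' : chi' 1%g = 1 by rewrite ek' (_ : k' = 1%N) //; lia.
have lin_i : 'chi_i \is a linear_char by rewrite qualifE /= irr_char ek eqxx.
have e_lin : e \is a linear_char := detRepr_lin_char rV.
have /irrP[j jE] := mul_lin_irr e_lin (mem_irr i).
have neq_ij : i != j.
  apply/eqP => ij; have := lin_char_neq0 lin_i (reflW 0).
  have := congr1 (fun phi : 'CF(W) => phi (c ^+ 0 * s0)%g) jE.
  rewrite -ij mulE e_refl mulN1r => /eqP; rewrite -subr_eq0 -opprD oppr_eq0.
  by rewrite -mulr2n mulrn_eq0 => /eqP->; rewrite eqxx.
have j_constt : j \in irr_constt chi'.
  rewrite irr_consttE; have -> : chi' = dih b - 'chi_i by rewrite dihE addrC addKr.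
  rewrite cfdotBl cfdot_irr (negbTE neq_ij) subr0 -jE.
  by rewrite -(sgn_dih b) cfdot_sgn.
have [chi2 ch2 chi'E] := constt_charP j ch' j_constt.
have ej : 'chi_j 1%g = 1 by rewrite -jE mulE ek lin_char1 ?mulr1.
have /eqP : chi2 1%g = 0.
  by apply: (addrI ('chi_j 1%g)); rewrite -addE -chi'E ek' ej addr0.
rewrite char1_eq0 // => /eqP chi20.
rewrite dihE chi'E chi20 addr0 jE; split=> //.
by rewrite cfdotDl !cfdot_irr eqxx eq_sym (negbTE neq_ij) addr0.
Qed.

(** The irreducible characters: the trivial one, the sign, the induced
    characters of degree 2, and, when [m] is even, the two constituents of
    [dih m./2], which the sign exchanges. *)
Lemma irr_dihedral i (b := fake_degree rV i) :
  [\/ b = 0%N /\ i = 0, b = m /\ 'chi_i = e,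
      (0 < b)%N /\ (b.*2 < m)%N /\ 'chi_i = dih b
    | [/\ b.*2 = m, 'chi_i + e * 'chi_i = dih b, V * 'chi_i = dih b.-1, 'chi_i != e
        & '[dih b, 'chi_i] = 1]].
Proof.
have [le_bm Cb b_min] := fake_degreeP i; rewrite -/b in le_bm Cb b_min.
have [b0|b0] := posnP b.
  constructor 1; split=> //; move: Cb.
  rewrite b0 (coinv_char0 m1 hW hV) -irr0 cfdot_irr pnatr_eq0 eqb0 negbK => /eqP.
  by [].
move: le_bm; rewrite leq_eqVlt => /orP[/eqP bm|lt_bm].
  constructor 2; split=> //; apply: irr_of_norm1 sgn_norm _; first exact: cfRepr_char.
  by rewrite -coinv_top -bm.
have CE : C b = dih b by rewrite coinv_dih ?b0.
have le_b2 : (b.*2 <= m)%N.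
  (* [dih b = dih (m - b)], so the first occurrence is in the lower half. *)
  rewrite leqNgt; apply/negP => lt_m; case/negP: Cb; apply/eqP.
  have lt_mb : (m - b < b)%N by lia.
  by rewrite CE -(dih_sym (ltnW lt_bm)) -coinv_dih ?b_min // subn_gt0 lt_bm /=; lia.
have chb : dih b \is a character by rewrite -CE coinv_is_char.
have nb : '[dih b] = (m %| b.*2)%:R + 1.
  by rewrite cfdot_dih // addnn subnn dvdn0.
move: le_b2; rewrite leq_eqVlt => /orP[/eqP b2m|lt_b2]; last first.
  constructor 3; split=> //; split=> //; apply: irr_of_norm1 => //; last by rewrite -CE.
  by rewrite nb dvd_small ?add0r // double_gt0 b0.
have nb2 : '[dih b] = 2 by rewrite nb b2m dvdnn -(natrD _ 1 1).
have Cb' : '[dih b, 'chi_i] != 0 by rewrite -CE.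
constructor 4; have [chiE dot1] := split_dih b2m chb nb2 Cb'.
split=> //.
  have : V * dih b = dih b.-1 + dih b.-1.
    rewrite mulrC -[V]/(dih 1) dih_mul // addrC subn1 addn1; congr (_ + _).
    by rewrite -dih_sym; [congr dih | ]; lia.
  rewrite -chiE mulrDr mulrA (mulrC V e) sgn_V -!mulr2n -!scaler_nat.
  by apply: scalerI; rewrite pnatr_eq0.
apply/eqP => chie; have := cfdot_dih_1 b.
rewrite -chiE chie sgn_sgn cfdotDl cfnorm1 dvd_small ?b0 // => /eqP.
rewrite gt_eqF // ltr_wpDl ?ltr01 // -irr0 cfdot_natP //; exact: cfRepr_char.
Qed.

End DihedralCharacters.

(** * Graded multiplicities *)

Section GradedMultiplicity.

Variables (gT : finGroupType) (W : {group gT}) (K : comNzRingType) (x : K).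
Implicit Types (phi psi : 'CF(W)) (F G : {poly 'CF(W)}).

(** Meant for the integers of [algC], on which it is a ring morphism. *)
Definition intval (a : algC) : K := (Num.floor a)%:~R.

Lemma intval0 : intval 0 = 0. Proof. by rewrite /intval floor0. Qed.

Lemma intvalD : {in Num.int &, {morph intval : a b / a + b}}.
Proof. by move=> a b /intrP[i ->] /intrP[j ->]; rewrite /intval -rmorphD !intrKfloor rmorphD. Qed.

Lemma intvalM : {in Num.int &, {morph intval : a b / a * b}}.
Proof. by move=> a b /intrP[i ->] /intrP[j ->]; rewrite /intval -rmorphM !intrKfloor rmorphM. Qed.

Lemma intval_sum (I : finType) (f : I -> algC) : (forall i, f i \is a Num.int) ->
  intval (\sum_i f i) = \sum_i intval (f i).
Proof.
move=> Zf; suff: \sum_i f i \is a Num.int /\ intval (\sum_i f i) = \sum_i intval (f i) by case.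
elim/big_ind2: _ => [|a a' b b' [Za <-] [Zb <-]|i _]; first by rewrite rpred0 intval0.
  by rewrite rpredD ?intvalD.
by rewrite Zf.
Qed.

Lemma intvalB : {in Num.int &, {morph intval : a b / a - b}}.
Proof. by move=> a b /intrP[i ->] /intrP[j ->]; rewrite /intval -rmorphB !intrKfloor rmorphB. Qed.

Lemma intval_nat n : intval n%:R = n%:R.
Proof. by rewrite /intval -[n%:R in LHS]/(n%:Z%:~R) intrKfloor. Qed.

(** For [psi] irreducible and [x] equal to q this is a coordinate in the
    Grothendieck group; for [x] equal to ['X] it is the polynomial behind it. *)
Definition gmult psi F : K := \sum_(n < size F) intval '[F`_n, psi] * x ^+ n.

Lemma gmult_wide N psi F : (size F <= N)%N ->
  gmult psi F = \sum_(n < N) intval '[F`_n, psi] * x ^+ n.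
Proof.
move=> le_FN; rewrite /gmult (big_ord_widen _ (fun n => intval '[F`_n, psi] * x ^+ n) le_FN).
rewrite big_mkcond; apply: eq_bigr => n _; case: ltnP => // le_Fn.
by rewrite nth_default // cfdot0l intval0 mul0r.
Qed.

Lemma gmult0 psi : gmult psi 0 = 0.
Proof. by rewrite /gmult size_poly0 big_ord0. Qed.

Section Psi.

Variable psi : 'CF(W).
Hypothesis vpsi : psi \in 'Z[irr W]%g.

Let Zdot F n : F \is a polyOver 'Z[irr W]%g -> '[F`_n, psi] \is a Num.int.
Proof. by move/polyOverP=> vF; rewrite Cint_cfdot_vchar ?vF. Qed.

Lemma gmultD F G : F \is a polyOver 'Z[irr W]%g -> G \is a polyOver 'Z[irr W]%g ->
  gmult psi (F + G) = gmult psi F + gmult psi G.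
Proof.
move=> vF vG; pose N := maxn (size F) (size G).
rewrite !(@gmult_wide N) ?leq_maxl ?leq_maxr ?size_polyD // -big_split /=.
by apply: eq_bigr => n _; rewrite coefD cfdotDl intvalD ?Zdot // mulrDl.
Qed.

Lemma gmultN F : F \is a polyOver 'Z[irr W]%g -> gmult psi (- F) = - gmult psi F.
Proof.
move=> vF; apply: (addrI (gmult psi F)).
by rewrite -gmultD ?rpredN // !subrr gmult0.
Qed.

Lemma gmultB F G : F \is a polyOver 'Z[irr W]%g -> G \is a polyOver 'Z[irr W]%g ->
  gmult psi (F - G) = gmult psi F - gmult psi G.
Proof. by move=> vF vG; rewrite gmultD ?rpredN // gmultN. Qed.

Lemma gmult_sum (I : finType) (F : I -> {poly 'CF(W)}) :
    (forall i, F i \is a polyOver 'Z[irr W]%g) ->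
  gmult psi (\sum_i F i) = \sum_i gmult psi (F i).
Proof.
move=> vF.
suff: \sum_i F i \is a polyOver 'Z[irr W]%g /\
  gmult psi (\sum_i F i) = \sum_i gmult psi (F i) by case.
elim/big_ind2: _ => [|a a' b b' [va <-] [vb <-]|i _]; first by rewrite rpred0 gmult0.
  by rewrite rpredD ?gmultD.
by rewrite vF.
Qed.

Lemma gmultMXn F n : gmult psi (F * 'X^n) = gmult psi F * x ^+ n.
Proof.
have le_s : (size (F * 'X^n)%R <= n + size F)%N.
  apply: leq_trans (size_polyMleq _ _) _; rewrite size_polyXn.
  by rewrite addnS addnC.
rewrite (gmult_wide _ le_s) big_split_ord /= big1 ?add0r => [|k _]; last first.
  by rewrite coefMXn ltn_ord cfdot0l intval0 mul0r.
rewrite /gmult mulr_suml; apply: eq_bigr => k _.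
by rewrite coefMXn ltnNge leq_addr /= addKn exprD mulrA mulrAC.
Qed.

Lemma gmultC phi : gmult psi phi%:P = intval '[phi, psi].
Proof.
rewrite (@gmult_wide 1) ?size_polyC_leq1 // big_ord1 coefC eqxx expr0 mulr1 //.
Qed.

(** Tensoring with [F] can be done constituent by constituent. *)
Lemma gmult_mul F G : F \is a polyOver 'Z[irr W]%g -> G \is a polyOver 'Z[irr W]%g ->
  \sum_i gmult 'chi_i F * gmult psi (G * ('chi_i)%:P) = gmult psi (G * F).
Proof.
move=> vF vG; have vFn n : F`_n \in 'Z[irr W]%g by apply/polyOverP.
have vGn n : G`_n \in 'Z[irr W]%g by apply/polyOverP.
have constE phi : phi \in 'Z[irr W]%g ->
    gmult psi (G * phi%:P) = \sum_i intval '[phi, 'chi_i] * gmult psi (G * ('chi_i)%:P).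
  move=> vphi; have leG chi : (size (G * chi%:P)%R <= size G)%N.
    by apply: leq_trans (size_polyMleq _ _) _; have := size_polyC_leq1 chi; lia.
  rewrite (gmult_wide _ (leG phi)).
  under [RHS]eq_bigr => i _ do rewrite (gmult_wide _ (leG _)) mulr_sumr.
  rewrite exchange_big; apply: eq_bigr => n _ /=.
  under eq_bigr => i _ do rewrite mulrA.
  rewrite -mulr_suml; congr (_ * _); rewrite coefMC {1}(cfun_sum_cfdot phi).
  rewrite mulr_sumr cfdot_suml intval_sum => [|i].
    apply: eq_bigr => i _; rewrite coefMC -scalerAr cfdotZl intvalM //.
      by rewrite Cint_cfdot_vchar_irr.
    by rewrite Cint_cfdot_vchar // rpredM // irr_vchar.
  by rewrite -scalerAr cfdotZl rpredM ?Cint_cfdot_vchar_irr ?Cint_cfdot_vchar //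
    rpredM // irr_vchar.
have FE : F = \sum_(n < size F) (F`_n)%:P * 'X^n.
  by rewrite -{1}[F]coefK poly_def; apply: eq_bigr => n _; rewrite mul_polyC.
rewrite [in RHS]FE mulr_sumr gmult_sum => [|n]; last first.
  by rewrite rpredM // rpredM ?polyOverC ?polyOverXn.
under [RHS]eq_bigr => n _ do rewrite mulrA gmultMXn constE ?vFn // mulr_suml.
rewrite exchange_big; apply: eq_bigr => i _ /=.
rewrite /gmult mulr_suml; apply: eq_bigr => n _.
by rewrite mulrAC.
Qed.

End Psi.

End GradedMultiplicity.

Lemma rmorph_gmult (gT : finGroupType) (W : {group gT}) (K L : comNzRingType)
    (f : {rmorphism K -> L}) x (psi : 'CF(W)) F :
  f (gmult x psi F) = gmult (f x) psi F.
Proof.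
rewrite rmorph_sum; apply: eq_bigr => n _.
by rewrite rmorphM rmorphXn /intval rmorph_int.
Qed.

(** * Triangular factorizations and power series *)

Section Triangular.

Variables (K : fieldType) (I : finType) (le : rel I) (Q : I -> I -> K) (d : I -> K).
Hypotheses (le_refl : reflexive le) (le_anti : antisymmetric le) (le_trans : transitive le).
Hypotheses (Q_le : forall i j, ~~ le i j -> Q i j = 0) (Qii : forall i, Q i i = d i).
Hypothesis (d0 : forall i, d i != 0).

Let below c i : (forall j, le j i -> j != i -> c j = 0) ->
  \sum_k c k * Q k i = c i * d i.
Proof.
move=> ci; rewrite (bigD1 i) //= Qii big1 ?addr0 // => k ki.
by have [/ci->|/Q_le->] := boolP (le k i); rewrite ?mul0r ?mulr0.
Qed.

Let tri_coef0 c i : (forall j, le j i -> j != i -> \sum_k c k * Q k j = 0) ->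
  forall j, le j i -> j != i -> c j = 0.
Proof.
move=> ci j; move: {2}_.+1 (ltnSn #|[pred k | le k j]|) => n.
elim: n j => // n IHn j lt_jn le_ji ji.
have := ci j le_ji ji; rewrite below => [|k le_kj kj].
  by move/eqP; rewrite mulf_eq0 (negbTE (d0 j)) orbF => /eqP.
apply: IHn; last 1 first.
- by apply: contra kj => /eqP ki; apply/eqP/le_anti; rewrite le_kj ki le_ji.
- rewrite -ltnS (leq_trans _ lt_jn) // ltnS; apply: proper_card; apply/properP; split.
    by apply/subsetP=> l; rewrite !inE => /le_trans; apply.
  exists j; rewrite !inE ?le_refl //; apply: contra kj => le_jk.
  by apply/eqP/le_anti; rewrite le_kj.
exact: le_trans le_ji.
Qed.

Lemma triangular_free c : (forall j, \sum_k c k * Q k j = 0) -> forall i, c i = 0.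
Proof.
move=> c0 i; have := c0 i; rewrite below => [|j le_ji ji].
  by move/eqP; rewrite mulf_eq0 (negbTE (d0 i)) orbF => /eqP.
by apply: (@tri_coef0 c i).
Qed.

(** If p = y Omega with [p] supported above and [y] below [i], then
    p = sum_l c_l Q_l with c = y Q^T Lambda supported below [i], while
    triangularity kills the coefficients strictly below [i]. *)
Lemma triangular_unique lambda (Omega : I -> I -> K) p y i :
    (forall j k, Omega j k = \sum_l lambda l * Q l j * Q l k) ->
    (forall k, \sum_j y j * Omega j k = p k) ->
    (forall j, y j != 0 -> le j i) -> (forall j, p j != 0 -> le i j) -> p i = d i ->
  (forall k, Q i k = p k) /\ lambda i * (d i * y i) = 1.
Proof.
move=> OmegaE yOmega y_le p_le pi.
pose c l := lambda l * \sum_j y j * Q l j.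
have pE k : p k = \sum_l c l * Q l k.
  rewrite -yOmega; under eq_bigr => j _ do rewrite OmegaE mulr_sumr.
  rewrite exchange_big; apply: eq_bigr => l _ /=.
  rewrite /c mulr_sumr mulr_suml; apply: eq_bigr => j _.
  by ring.
have c_le l : ~~ le l i -> c l = 0.
  move=> nle; rewrite /c big1 ?mulr0 // => j _.
  have [/Q_le->|] := boolP (~~ le l j); first by rewrite mulr0.
  rewrite negbK => le_lj; have [->|/y_le le_ji] := eqVneq (y j) 0; first by rewrite mul0r.
  by rewrite (le_trans le_lj) in nle.
have c_lt j : le j i -> j != i -> c j = 0.
  apply: tri_coef0 => k le_ki ki; rewrite -pE.
  by apply: contraNeq ki => /p_le le_ik; apply/eqP/le_anti; rewrite le_ki.
have c0 j : j != i -> c j = 0.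
  by move=> ji; have [le_ji|/c_le//] := boolP (le j i); apply: c_lt.
have ci : c i = 1.
  by apply: (mulIf (d0 i)); rewrite mul1r -below // -pE.
split=> [k|].
  by rewrite pE (bigD1 i) //= ci mul1r big1 ?addr0 // => j /c0->; rewrite mul0r.
rewrite -ci /c (bigD1 i) //= Qii big1 ?addr0 ?[d i * _]mulrC // => j ji.
have [/Q_le->|] := boolP (~~ le i j); first by rewrite mulr0.
rewrite negbK => le_ij; have [->|/y_le le_ji] := eqVneq (y j) 0; first by rewrite mul0r.
by case/eqP: ji; apply: le_anti; rewrite le_ij le_ji.
Qed.

End Triangular.

Section Expansion.

Implicit Types (a : nat -> rat) (p d : {poly rat}).

(** Both sides are the product of d, d' and the power series a, truncated here
    above the degree under consideration. *)
Let expands_cross a p d p' d' :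
    (forall n, \sum_(i < n.+1) d`_i * a (n - i)%N = p`_n) ->
    (forall n, \sum_(i < n.+1) d'`_i * a (n - i)%N = p'`_n) ->
  p * d' = p' * d.
Proof.
move=> dp dp'; apply/polyP=> n; pose A := \poly_(i < n.+1) a i.
have trunc (u r s : {poly rat}) : (forall k, \sum_(i < k.+1) u`_i * a (k - i)%N = r`_k) ->
    (r * s)`_n = (u * A * s)`_n.
  move=> ur; rewrite !coefM; apply: eq_bigr => i _; congr (_ * _).
  rewrite -ur coefM; apply: eq_bigr => j _; congr (_ * _).
  rewrite coef_poly ifT // ltnS (leq_trans (leq_subr _ _)) // -ltnS; exact: ltn_ord.
rewrite (trunc _ _ d' dp) (trunc _ _ d dp').
by rewrite mulrAC [d * d']mulrC mulrAC.
Qed.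

Lemma series_sumE a f : expands_to a f -> series_sum a = f.
Proof.
move=> af; apply: classical_sets.xget_unique => // g ag.
case: af ag => p [d [d0 -> dp]] [p' [d' [d'0 -> dp']]].
have nz (u : {poly rat}) : u`_0 != 0 -> tofrac u != 0.
  by move=> u0; rewrite tofrac_eq0; apply: contraNneq u0 => ->; rewrite coef0.
apply/eqP; rewrite eqr_div ?nz // -!tofracM; apply/eqP; congr tofrac.
exact: expands_cross dp' dp.
Qed.

Lemma conv_Xn a k n :
  \sum_(i < n.+1) ('X^k : {poly rat})`_i * a (n - i)%N = if (k <= n)%N then a (n - k)%N else 0.
Proof.
case: leqP => [le_kn|lt_nk].
  have lt_k : (k < n.+1)%N by [].
  rewrite (bigD1 (Ordinal lt_k)) //= coefXn eqxx mul1r big1 ?addr0 // => i.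
  by rewrite -val_eqE /= coefXn => /negbTE->; rewrite mul0r.
apply: big1 => i _; rewrite coefXn ltn_eqF ?mul0r //.
by apply: leq_ltn_trans lt_nk; rewrite -ltnS.
Qed.

End Expansion.

(** * Green functions *)

Section Polynomials.

Variables (R : comNzRingType) (e v x : R).
Hypotheses (ee : e * e = 1) (ev : e * v = v).
Local Notation kos := (1 - v * x + e * x ^+ 2).
Local Notation dih := (cheb e v).

Lemma koszul_mid b :
  e * (kos * (\sum_(n < b.+1) dih n * x ^+ n - e))
    = e - e * x ^+ 2 - dih b.+1 * x ^+ b.+1 + dih b * x ^+ b.+2.
Proof.
rewrite koszul_cheb // mulrDr !mulrBr mulr1 !mulrA !mul_sgn_cheb //.
Qed.

Lemma koszul_half b chi : chi + e * chi = dih b.+1 -> v * chi = dih b ->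
  e * (kos * (\sum_(n < b.+1) dih n * x ^+ n - e + chi * x ^+ b.+1))
    = e - e * x ^+ 2 - chi * x ^+ b.+1 + chi * x ^+ b.+3.
Proof.
move=> chiE vchi; rewrite mulrDr mulrDr koszul_mid -chiE -vchi.
have -> : kos * (chi * x ^+ b.+1) =
    chi * x ^+ b.+1 - (v * chi) * x ^+ b.+2 + (e * chi) * x ^+ b.+3.
  by rewrite !exprS; ring.
rewrite mulrDr !mulrBr !(mulrA e) ev ee !mul1r; ring.
Qed.

Lemma koszul_top m : dih m = dih 0 -> dih m.+1 = dih 1 ->
  kos * (\sum_(n < m.+1) dih n * x ^+ n - e - x ^+ m) = (1 - x ^+ 2) * (1 - x ^+ m).
Proof.
move=> dm dm1; rewrite mulrBr koszul_cheb // dm dm1 /= !exprS; ring.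
Qed.

End Polynomials.

Section DihedralGreen.

Variables (m : nat) (gT : finGroupType) (W : {group gT}) (s0 s1 : gT).
Hypotheses (m1 : (1 < m)%N) (hW : I2_system m W s0 s1).
Variables (rV : mx_representation algC W 2) (hV : is_reflection_repr m s0 s1 rV).

Local Notation V := (cfRepr rV).
Local Notation e := (detRepr rV).
Local Notation dih := (dih rV).
Local Notation C := (coinv_char rV).
Local Notation S := (sym_char rV).
Local Notation fdeg := (fake_degree rV).

Let ee := sgn_sgn m1 hW hV.
Let ev := sgn_V m1 hW hV.
Let m0 : (0 < m)%N := ltnW m1.
Let C0 := coinv_char0 m1 hW hV.

Definition coinv_poly : {poly 'CF(W)} := \sum_(n < m.+1) (C n)%:P * 'X^n.
Definition koszul_poly : {poly 'CF(W)} := 1 - V%:P * 'X + e%:P * 'X^2.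

(** The coinvariant algebra, truncated in the degree where 'chi_i first occurs;
    [green_unique] identifies it with the output of the algorithm. *)
Definition green i : {poly 'CF(W)} :=
  \sum_(n < fdeg i) (C n)%:P * 'X^n + ('chi_i)%:P * 'X^(fdeg i).

Let eeP : e%:P * e%:P = 1 :> {poly 'CF(W)}. Proof. by rewrite -polyCM ee. Qed.
Let evP : e%:P * V%:P = V%:P :> {poly 'CF(W)}. Proof. by rewrite -polyCM ev. Qed.

Let chebP n : cheb e%:P V%:P n = (dih n)%:P.
Proof.
suff: cheb e%:P V%:P n = (dih n)%:P /\ cheb e%:P V%:P n.+1 = (dih n.+1)%:P by case.
elim: n => [|n [IH1 IH2]]; first by split=> //=; rewrite polyCD polyC1.
by split=> //; rewrite chebSS IH1 IH2 -polyCM -polyCB.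
Qed.

Let sum_coinv_dih b : (0 < b <= m)%N ->
  \sum_(n < b) (C n)%:P * 'X^n = \sum_(n < b) cheb e%:P V%:P n * 'X^n - e%:P.
Proof.
case: b => // b /andP[_ lt_bm]; under [in RHS]eq_bigr do rewrite chebP.
have dih0 : (dih 0)%:P = 1 + e%:P by rewrite polyCD polyC1.
rewrite !big_ord_recl C0 dih0 !expr0 !mulr1 [RHS]addrAC addrK polyC1; congr (_ + _).
apply: eq_bigr => n _; rewrite (coinv_dih m1 hW hV) //.
by rewrite lift0 (leq_trans _ lt_bm) // ltnS ltn_ord.
Qed.

Lemma coinv_polyE : coinv_poly = \sum_(n < m.+1) cheb e%:P V%:P n * 'X^n - e%:P - 'X^m.
Proof.
rewrite /coinv_poly !big_ord_recr /= sum_coinv_dih ?m0 ?leqnn // chebP.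
have -> : dih m = 1 + e by rewrite -[m]add0n (dih_periodic m1 hW hV).
rewrite (coinv_top m1 hW hV) polyCD polyC1; move: (\sum_(i < m) _) => A.
by rewrite mulrDl mul1r; ring.
Qed.

Lemma koszul_coinv : koszul_poly * coinv_poly = (1 - 'X^2) * (1 - 'X^m).
Proof.
rewrite coinv_polyE -[koszul_poly]/(1 - V%:P * 'X + e%:P * 'X ^+ 2).
rewrite koszul_top //; rewrite !chebP.
  by rewrite -[m]add0n (dih_periodic m1 hW hV).
by rewrite -add1n (dih_periodic m1 hW hV).
Qed.

Let vch_e : e \in 'Z[irr W]%g. Proof. by rewrite char_vchar ?cfRepr_char. Qed.
Let vch_V : V \in 'Z[irr W]%g. Proof. by rewrite char_vchar ?cfRepr_char. Qed.
Let vch_C n : C n \in 'Z[irr W]%g. Proof. by rewrite char_vchar ?cfRepr_char. Qed.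
Let vch_1 : 1 \in 'Z[irr W]%g. Proof. exact: rpred1. Qed.
Let vch_dih n : dih n \in 'Z[irr W]%g.
Proof.
suff: dih n \in 'Z[irr W]%g /\ dih n.+1 \in 'Z[irr W]%g by case.
elim: n => [|n [IH1 IH2]]; first by rewrite rpredD.
by split=> //; rewrite /dih chebSS rpredB ?rpredM.
Qed.
Let vch_irr i : 'chi[W]_i \in 'Z[irr W]%g. Proof. exact: irr_vchar. Qed.

Let vM phi n : phi \in 'Z[irr W]%g -> phi%:P * 'X^n \is a polyOver 'Z[irr W]%g.
Proof. by move=> vphi; rewrite rpredM ?polyOverC ?polyOverXn. Qed.

Lemma green_vchar i : green i \is a polyOver 'Z[irr W]%g.
Proof. by rewrite rpredD ?vM // rpred_sum // => n _; rewrite vM. Qed.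

Lemma coinv_poly_vchar : coinv_poly \is a polyOver 'Z[irr W]%g.
Proof. by rewrite rpred_sum // => n _; rewrite vM. Qed.

Lemma koszul_poly_vchar : koszul_poly \is a polyOver 'Z[irr W]%g.
Proof. by rewrite rpredD ?vM // rpredB ?rpred1 // rpredM ?polyOverC ?polyOverX. Qed.

(** Up to the factor q^m D, the preimage of [green i] under Omega. *)
Definition dual_green i := e%:P * (koszul_poly * green i).

Let greenE i : (0 < fdeg i <= m)%N ->
  green i = \sum_(n < fdeg i) cheb e%:P V%:P n * 'X^n - e%:P + ('chi_i)%:P * 'X^(fdeg i).
Proof. by move=> b_bound; rewrite /green sum_coinv_dih. Qed.

Let sum4 (a0 a1 a2 a3 : 'CF(W)) k l r : {poly 'CF(W)} :=
  a0%:P - a1%:P * 'X^k - a2%:P * 'X^l + a3%:P * 'X^r.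

(** The four kinds of irreducible characters.  The trivial one fits the shape of
    the other three with a zero term. *)
Lemma dual_green_cases i (b := fdeg i) : [\/
    [/\ i = 0, b = 0%N, green i = 1 & dual_green i = sum4 e 0 V 1 0 1 2],
    [/\ 'chi_i = e, b = m, green i = coinv_poly & dual_green i = sum4 e e e e 2 m m.+2],
    [/\ (0 < b)%N, (b.*2 < m)%N, 'chi_i = dih b
      & dual_green i = sum4 e e (dih b.+1) (dih b) 2 b.+1 b.+2]
  | [/\ b.*2 = m, 'chi_i != e, '[dih b, 'chi_i] = 1
      & dual_green i = sum4 e e 'chi_i 'chi_i 2 b b.+2]].
Proof.
have dualE (P : {poly 'CF(W)}) : e%:P * (koszul_poly * P) =
    e%:P * ((1 - V%:P * 'X + e%:P * 'X ^+ 2) * P) by [].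
case: (irr_dihedral m1 hW hV i); rewrite -/b.
- move=> [b0 i0]; constructor 1; have gE : green i = 1.
    by rewrite /green -/b b0 big_ord0 add0r i0 irr0 mulr1 polyC1.
  split=> //; rewrite /dual_green gE dualE mulr1 /sum4 polyC0 polyC1 mul0r subr0 mul1r.
  by rewrite mulrDr mulrBr mulr1 !mulrA evP eeP mul1r expr1.
- move=> [bm chie]; constructor 2; have gE : green i = coinv_poly.
    by rewrite /green /coinv_poly -/b bm big_ord_recr /= chie (coinv_top m1 hW hV).
  split=> //; rewrite /dual_green gE koszul_coinv /sum4 !exprS.
  move: e%:P ('X^m : {poly 'CF(W)}) => E X; ring.
- move=> [b0 [lt_bm chiE]]; constructor 3; split=> //.
  rewrite /dual_green greenE -/b ?b0 /=; last by rewrite -addnn in lt_bm; lia.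
  rewrite chiE -chebP addrAC.
  have := big_ord_recr b (fun n : 'I_b.+1 => cheb e%:P V%:P n * 'X^n : {poly 'CF(W)}).
  by move=> /= <-; rewrite dualE koszul_mid // !chebP.
move=> [b2m chiE vchi nchi dot1]; constructor 4; split=> //.
have b0 : (0 < b)%N by rewrite -double_gt0 b2m.
rewrite /dual_green greenE -/b ?b0 /=; last by rewrite -b2m -addnn leq_addr.
move: b b0 {b2m dot1} chiE vchi => [//|b] _ chiE vchi; rewrite dualE koszul_half //.
  by rewrite chebP -polyCM -polyCD chiE.
by rewrite chebP -polyCM vchi.
Qed.

Lemma fdeg_eq0 j : fdeg j = 0%N -> j = 0.
Proof.
move=> b0; case: (dual_green_cases j); rewrite b0.
- by case.
- by case=> _ mE; move: m0; rewrite -mE.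
- by case.
by case=> mE; move: m0; rewrite -mE.
Qed.

Let sgn_neq1 : e != 1.
Proof.
apply/eqP => e1; have := sgn_refl m1 hW hV 0.
rewrite e1 cfun1E groupM ?(rotX_in hW) ?(s0_in hW) // => /eqP.
by rewrite -subr_eq0 opprK -(natrD _ 1 1) pnatr_eq0.
Qed.

Let sgn_irr : exists j, e = 'chi_j.
Proof. by have /lin_char_irr/irrP := detRepr_lin_char rV. Qed.

Let dih_neq_sgn n : dih n != e.
Proof.
apply/eqP => dihe; have := sgn_refl m1 hW hV 0; rewrite -dihe (dih_refl m1 hW hV) => /eqP.
by rewrite eq_sym oppr_eq0 oner_eq0.
Qed.

Let cfdot_sgn_irr j : 'chi_j != e -> '[e, 'chi_j] = 0.
Proof.
case: sgn_irr => k ->; rewrite cfdot_irr; have [->|//] := eqVneq k j.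
by rewrite eqxx.
Qed.

Let cfdot_irr_sgn j : 'chi_j != e -> '['chi_j, e] = 0.
Proof. by move/cfdot_sgn_irr => dot0; rewrite cfdotC dot0 conjC0. Qed.

Let cfdot_sgn1 : '[e, 1] = 0.
Proof.
case: sgn_irr => k ek; rewrite ek -irr0 cfdot_irr; case: eqP => // k0.
by case/eqP: sgn_neq1; rewrite ek k0 irr0.
Qed.

Let cfdot_1sgn : '[1, e] = 0.
Proof. by rewrite cfdotC cfdot_sgn1 conjC0. Qed.

Lemma fdeg_sgn j : 'chi_j = e -> fdeg j = m.
Proof.
move=> je; case: (dual_green_cases j).
- by case=> j0; case/eqP: sgn_neq1; rewrite -je j0 irr0.
- by case.
- by case=> _ _ chiE; case/eqP: (dih_neq_sgn (fdeg j)); rewrite -chiE.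
by case=> _; rewrite je eqxx.
Qed.

Let dvd_small n : (0 < n < m)%N -> (m %| n)%N = false.
Proof. by case/andP=> n0 lt_nm; rewrite gtnNdvd. Qed.

Let coinv_1 n : (n < m)%N -> '[C n, 1] = (n == 0%N)%:R.
Proof.
case: posnP => [-> _|n0 lt_nm]; first by rewrite C0 cfnorm1.
by rewrite (coinv_dih m1 hW hV) ?n0 // (cfdot_dih_1 m1 hW hV) dvd_small ?n0 // gtn_eqF.
Qed.

Let coinv_sgn n : (n < m)%N -> '[C n, e] = 0.
Proof.
case: (posnP n) => [-> _|n0 lt_nm]; first by rewrite C0 cfdot_1sgn.
rewrite (coinv_dih m1 hW hV) ?n0 //; have := cfdot_sgn m1 hW hV (dih n) 1.
by rewrite (sgn_dih m1 hW hV) mulr1 => ->; rewrite (cfdot_dih_1 m1 hW hV) dvd_small ?n0.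
Qed.

Let cfdot_1V : '[1, V] = 0.
Proof. by rewrite cfdotC -[V]/(dih 1) (cfdot_dih_1 m1 hW hV) dvd_small ?m1 // conjC0. Qed.

Let coinv_V n : (n < m)%N -> '[C n, V] = (n == m.-1)%:R + (n == 1%N)%:R.
Proof.
case: (posnP n) => [-> _|n0 lt_nm].
  by rewrite C0 cfdot_1V ltn_eqF ?addr0 // -subn1 subn_gt0.
rewrite (coinv_dih m1 hW hV) ?n0 // -[V]/(dih 1) (cfdot_dih m1 hW hV) //; congr (_%:R + _%:R).
  have [-> | neq] := eqVneq n m.-1; first by rewrite addn1 prednK // dvdnn.
  by rewrite dvd_small //; lia.
have [-> | neq] := eqVneq n 1%N; first by rewrite subnn dvdn0.
by rewrite dvd_small //; lia.
Qed.

Let cfdot_sgnV : '[e, V] = 0.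
Proof. by have := cfdot_sgn m1 hW hV 1 V; rewrite mulr1 ev cfdot_1V. Qed.

Section Evaluation.

Variables (K : comNzRingType) (x : K).
Local Notation iv := (@intval K).
Local Notation gm := (gmult x).

Let iv0 : iv 0 = 0. Proof. exact: (intval_nat K 0). Qed.
Let iv1 : iv 1 = 1. Proof. exact: (intval_nat K 1). Qed.

Lemma gmult_sum4 psi a0 a1 a2 a3 k l r :
    [/\ psi \in 'Z[irr W]%g, a0 \in 'Z[irr W]%g, a1 \in 'Z[irr W]%g, a2 \in 'Z[irr W]%g
      & a3 \in 'Z[irr W]%g] ->
  gm psi (sum4 a0 a1 a2 a3 k l r) =
    iv '[a0, psi] - iv '[a1, psi] * x ^+ k - iv '[a2, psi] * x ^+ l + iv '[a3, psi] * x ^+ r.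
Proof.
case=> vpsi v0 v1 v2 v3; rewrite /sum4 gmultD ?gmultB ?gmultMXn ?gmultC //;
  by rewrite ?rpredB ?vM ?polyOverC.
Qed.

Lemma gmult_green psi i : psi \in 'Z[irr W]%g ->
  gm psi (green i) =
    \sum_(n < fdeg i) iv '[C n, psi] * x ^+ n + iv '['chi_i, psi] * x ^+ fdeg i.
Proof.
move=> vpsi; rewrite gmultD ?vM ?rpred_sum // => [|n _]; last exact: vM.
rewrite gmult_sum // => [|n]; last exact: vM.
by rewrite gmultMXn gmultC; congr (_ + _); apply: eq_bigr => n _; rewrite gmultMXn gmultC.
Qed.

Let coinv_below i j n : (fdeg i <= fdeg j)%N -> (n < fdeg i)%N -> '[C n, 'chi_j] = 0.
Proof.
move=> le_b lt_n; have [_ _] := fake_degreeP m1 hW hV j.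
by apply; apply: leq_trans le_b.
Qed.

Lemma green_diag i : gm 'chi_i (green i) = x ^+ fdeg i.
Proof.
rewrite gmult_green // cfdot_irr eqxx iv1 mul1r big1 ?add0r // => n _.
by rewrite (coinv_below (leqnn _)) ?iv0 ?mul0r.
Qed.

Lemma green_support i j : gm 'chi_j (green i) != 0 -> j = i \/ (fdeg j < fdeg i)%N.
Proof.
move=> nz; have [->|ji] := eqVneq j i; first by left.
right; rewrite ltnNge; apply: contra nz => le_b.
have dot_ij : '['chi_i, 'chi_j] = 0 by rewrite cfdot_irr eq_sym (negbTE ji).
apply/eqP; rewrite gmult_green // dot_ij iv0 mul0r addr0 big1 // => n _.
by rewrite (coinv_below le_b) ?iv0 ?mul0r.
Qed.

(** The only constituents of [dih b.+1] are of fake degree [b.+1], unless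
    [b.*2.+1 = m], when it equals [dih b]. *)
Lemma dual_green_support i j : gm 'chi_j (dual_green i) != 0 -> j = i \/ (fdeg i < fdeg j)%N.
Proof.
move=> nz; have [->|ji] := eqVneq j i; first by left.
right; rewrite ltnNge; apply: contra nz => le_b; apply/eqP.
have dot_ij : '['chi_i, 'chi_j] = 0 by rewrite cfdot_irr eq_sym (negbTE ji).
have dot_ej : (fdeg i < m)%N -> '[e, 'chi_j] = 0.
  move=> lt_bm; apply: cfdot_sgn_irr; apply/eqP => /fdeg_sgn bj.
  by move: le_b; rewrite bj leqNgt lt_bm.
case: (dual_green_cases i).
- by case=> i0 b0; move: le_b; rewrite b0 leqn0 => /eqP/fdeg_eq0 j0; case/eqP: ji; rewrite i0.
- by case=> chie _ _ ->; rewrite gmult_sum4 // -chie dot_ij iv0 !mul0r !subr0 addr0.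
- case=> b0 lt_b chiE ->; rewrite gmult_sum4 // -chiE dot_ij dot_ej;
    last by rewrite -addnn in lt_b; lia.
  suff -> : '[dih (fdeg i).+1, 'chi_j] = 0 by rewrite iv0 !mul0r !subr0 addr0.
  move: (fdeg i) b0 lt_b le_b chiE => b b0 lt_b le_b chiE.
  case: (dual_green_cases j).
  + by case=> -> *; rewrite irr0 (cfdot_dih_1 m1 hW hV) dvd_small //; lia.
  + by case=> _ bj; lia.
  + case=> bj0 lt_bj chjE _; rewrite chjE (cfdot_dih m1 hW hV) ?leqW //.
    rewrite (dvd_small (n := _ - _)) ?addr0; last by lia.
    have [bm|neq_m] := eqVneq (b.+1 + fdeg j)%N m; last by rewrite dvd_small //; lia.
    by case/eqP: ji; apply: irr_inj; rewrite chiE chjE; congr dih; lia.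
  by case=> bj; lia.
case=> b2 nchi _ ->; rewrite gmult_sum4 // dot_ij dot_ej ?iv0 ?mul0r ?subr0 ?addr0 //.
by have := m0; lia.
Qed.

End Evaluation.

Section Values.

Variables (K : comNzRingType) (x : K) (t : nat).
Local Notation iv := (@intval K).
Local Notation gm := (gmult x).

Let iv0 : iv 0 = 0. Proof. exact: (intval_nat K 0). Qed.
Let iv1 : iv 1 = 1. Proof. exact: (intval_nat K 1). Qed.

(** At x = q this is the numerator of the q-Kreweras number, see [Krew_green]. *)
Definition green_pairing i :=
  gm e (green i) - x ^+ t * gm V (green i) + x ^+ t.*2 * gm 1 (green i).

Let green_1 i : (0 < fdeg i <= m)%N -> gm 1 (green i) = 1.
Proof.
case/andP=> b0 le_bm; rewrite (gmult_green _ _ vch_1).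
have -> : '['chi_i, 1] = 0.
  rewrite -irr0 cfdot_irr; case: eqP => // i0; move: b0; rewrite i0.
  case: (dual_green_cases 0) => [[_ -> //]|[e1 _ _ _]|[b0 lt_b chiE _]|[b2 _ dot1 _]] _.
  - by case/eqP: sgn_neq1; rewrite -e1 irr0.
  - have := cfdot_dih_1 m1 hW hV (fdeg 0); rewrite -chiE irr0 cfnorm1 dvd_small.
      by move/eqP; rewrite oner_eq0.
    by rewrite b0 /=; lia.
  move: dot1; rewrite irr0 (cfdot_dih_1 m1 hW hV) dvd_small.
    by move/eqP; rewrite eq_sym oner_eq0.
  by have := m0; lia.
rewrite iv0 mul0r addr0 -(prednK b0) big_ord_recl C0 cfnorm1 iv1 expr0 mulr1.
rewrite big1 ?addr0 // => n _; rewrite coinv_1 ?iv0 ?mul0r //.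
by rewrite lift0 (leq_trans _ le_bm) // -[X in (_ < X)%N](prednK b0) ltnS.
Qed.

Let sum_coinv_sgn b : (b <= m)%N -> \sum_(n < b) iv '[C n, e] * x ^+ n = 0.
Proof.
move=> le_bm; apply: big1 => n _; rewrite coinv_sgn ?iv0 ?mul0r //.
exact: leq_trans (ltn_ord n) le_bm.
Qed.

Let sum_delta b k : \sum_(n < b) (n == k :> nat)%:R * x ^+ n = if (k < b)%N then x ^+ k else 0.
Proof.
case: ltnP => [lt_kb|le_bk].
  rewrite (bigD1 (Ordinal lt_kb)) //= eqxx mul1r big1 ?addr0 // => n.
  by rewrite -val_eqE /= => /negbTE->; rewrite mul0r.
apply: big1 => n _; rewrite ltn_eqF ?mul0r //; exact: leq_trans (ltn_ord n) le_bk.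
Qed.

Let sum_coinv_V b : (b <= m)%N ->
  \sum_(n < b) iv '[C n, V] * x ^+ n =
    (if (m.-1 < b)%N then x ^+ m.-1 else 0) + (if (1 < b)%N then x else 0).
Proof.
move=> le_bm; rewrite -[X in _ + if _ then X else 0]expr1 -!sum_delta -big_split /=.
apply: eq_bigr => n _; rewrite coinv_V ?(leq_trans (ltn_ord n)) //.
by rewrite -natrD intval_nat natrD mulrDl.
Qed.

(** Degree 1 contributes <V, V> = 1 if it is below the fake degree, and
    <'chi_i, V> = 1 if it is the fake degree; degree m - 1, the next one where V
    occurs, is not below the fake degree. *)
Let green_V i : (0 < fdeg i)%N -> (fdeg i < m)%N -> '[dih (fdeg i), 'chi_i] = 1 ->
  gm V (green i) = x.
Proof.
move=> b0 lt_bm dot1; rewrite (gmult_green _ _ vch_V) sum_coinv_V; last exact: ltnW.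
have -> : (m.-1 < fdeg i)%N = false by apply/negbTE; rewrite -leqNgt; lia.
have VE : V = C 1 by rewrite (coinv_dih m1 hW hV) ?m1.
rewrite add0r; case: ltnP => [b1|le_b1].
  have [_ _ b_min] := fake_degreeP m1 hW hV i.
  by rewrite cfdotC VE b_min // conjC0 iv0 mul0r addr0.
have b1 : fdeg i = 1%N by apply/eqP; rewrite eqn_leq le_b1.
have dotV : '['chi_i, V] = 1.
  by rewrite cfdotC -[V]/(dih 1) -b1 dot1 conjC1.
by rewrite add0r dotV b1 iv1 mul1r expr1.
Qed.

Let pairing_mid i : (0 < fdeg i)%N -> (fdeg i < m)%N -> '[dih (fdeg i), 'chi_i] = 1 ->
  'chi_i != e -> green_pairing i = x ^+ t.*2 - x ^+ t.+1.
Proof.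
move=> b0 lt_bm dot1 nchi; have le_bm := ltnW lt_bm.
have bP : (0 < fdeg i <= m)%N by rewrite b0.
rewrite /green_pairing (green_V b0 lt_bm dot1) (green_1 bP) mulr1 (gmult_green _ _ vch_e).
rewrite (sum_coinv_sgn le_bm) (cfdot_irr_sgn nchi) iv0 mul0r addr0.
by rewrite exprSr sub0r addrC.
Qed.

Lemma green_values i (b := fdeg i) : [\/
    [/\ b = 0%N, gm V (green i) = 0, green_pairing i = x ^+ t.*2
      & gm 'chi_i (dual_green i) = x ^+ 2],
    [/\ b = m, gm V (green i) = x ^+ m.-1 + x,
        green_pairing i = x ^+ m - x ^+ t * (x ^+ m.-1 + x) + x ^+ t.*2
      & gm 'chi_i (dual_green i) = 1 - x ^+ 2 - x ^+ m + x ^+ m.+2],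
    [/\ (0 < b)%N /\ (b.*2 < m)%N, gm V (green i) = x,
        green_pairing i = x ^+ t.*2 - x ^+ t.+1
      & gm 'chi_i (dual_green i) = x ^+ b.+2 - (b.*2.+1 == m)%:R * x ^+ b.+1]
  | [/\ b.*2 = m, gm V (green i) = x, green_pairing i = x ^+ t.*2 - x ^+ t.+1
      & gm 'chi_i (dual_green i) = x ^+ b.+2 - x ^+ b]].
Proof.
case: (dual_green_cases i); rewrite -/b.
- case=> i0 b0 gE ->; constructor 1; have gC psi : gm psi 1 = iv '[1, psi].
    by rewrite -(gmultC x) polyC1.
  have V1 : '[V, 1] = 0 by rewrite cfdotC cfdot_1V conjC0.
  rewrite /green_pairing gE !gC cfdot_1V cfdot_1sgn cfnorm1 iv0 iv1 mulr0 subr0 mulr1 add0r.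
  split=> //; rewrite gmult_sum4 // ?i0 ?irr0 ?rpred0 //.
  by rewrite cfdot_sgn1 cfdot0l V1 cfnorm1 iv0 iv1 !mul0r !subr0 add0r mul1r.
- case=> chie bm _ ->; constructor 2.
  have gV : gm V (green i) = x ^+ m.-1 + x.
    rewrite (gmult_green _ _ vch_V) -/b bm sum_coinv_V // chie cfdot_sgnV iv0 mul0r addr0.
    by rewrite prednK // leqnn m1.
  have ge : gm e (green i) = x ^+ m.
    by rewrite (gmult_green _ _ vch_e) -/b bm sum_coinv_sgn // chie (sgn_norm rV) iv1 mul1r add0r.
  rewrite /green_pairing gV ge green_1 -/b ?bm ?m0 ?leqnn // mulr1; split=> //.
  by rewrite gmult_sum4 // -chie cfnorm_irr iv1 !mul1r.
- case=> b0 lt_b chiE ->; constructor 3.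
  have lt_bm : (b < m)%N by rewrite -addnn in lt_b; lia.
  have nchi : 'chi_i != e by rewrite chiE dih_neq_sgn.
  have dot1 : '[dih b, 'chi_i] = 1 by rewrite -chiE cfnorm_irr.
  rewrite pairing_mid // green_V //; split=> //.
  rewrite gmult_sum4 // cfdot_sgn_irr // dot1 chiE (cfdot_dih m1 hW hV) //.
  rewrite subSnn dvdn1 (gtn_eqF m1) addr0 intval_nat iv0 iv1 !mul0r subr0 sub0r mul1r addrC.
  congr (_ - _%:R * _); congr nat_of_bool; rewrite addSn addnn; apply/idP/eqP => [dvd_m|->].
    by apply/eqP; rewrite eqn_leq lt_b dvdn_leq.
  exact: dvdnn.
case=> b2 nchi dot1 ->; constructor 4.
have b0 : (0 < b)%N by rewrite -double_gt0 b2.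
have lt_bm : (b < m)%N by rewrite -b2 -addnn -[X in (X < _)%N]addn0 ltn_add2l.
rewrite pairing_mid // green_V //; split=> //.
by rewrite gmult_sum4 // cfdot_sgn_irr // cfnorm_irr iv0 iv1 !mul0r !mul1r subr0 sub0r addrC.
Qed.

End Values.

End DihedralGreen.

(** * The Lusztig-Shoji algorithm *)

Section LusztigShoji.

Variables (m : nat) (gT : finGroupType) (W : {group gT}) (s0 s1 : gT).
Hypotheses (m1 : (1 < m)%N) (hW : I2_system m W s0 s1).
Variables (rV : mx_representation algC W 2) (hV : is_reflection_repr m s0 s1 rV).

Local Notation V := (cfRepr rV).
Local Notation e := (detRepr rV).
Local Notation dih := (dih rV).
Local Notation C := (coinv_char rV).
Local Notation S := (sym_char rV).
Local Notation fdeg := (fake_degree rV).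
Local Notation coinv_poly := (coinv_poly m rV).
Local Notation koszul_poly := (koszul_poly rV).
Local Notation green := (green rV).
Local Notation dual_green := (dual_green rV).

Let m0 : (0 < m)%N := ltnW m1.
Let C0 := coinv_char0 m1 hW hV.

Local Notation gq := (gmult q).
Local Notation gX := (gmult ('X : {poly rat})).

Let mult_intval (K : comNzRingType) (phi : 'CF(W)) i : phi \is a character ->
  (mult phi i)%:R = intval K '[phi, 'chi_i].
Proof.
move=> chphi; have /natrP[n nE] : '[phi, 'chi_i] \is a Num.nat by apply: Cnat_cfdot_char_irr.
by rewrite /mult nE natrK intval_nat.
Qed.

Let coef_gX psi (F : {poly 'CF(W)}) n : (gX psi F)`_n = intval rat '[F`_n, psi].
Proof.
rewrite (@gmult_wide _ _ _ _ (maxn (size F) n.+1)) ?leq_maxl //.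
have lt_n : (n < maxn (size F) n.+1)%N by rewrite leq_maxr.
have intC (a : algC) : intval {poly rat} a = (intval rat a)%:P by rewrite /intval rmorph_int.
rewrite coef_sum (bigD1 (Ordinal lt_n)) //= intC coefCM coefXn eqxx mulr1.
rewrite big1 ?addr0 // => k; rewrite -val_eqE /= => /negbTE nk.
by rewrite intC coefCM coefXn eq_sym nk mulr0.
Qed.

Let tofrac_gX psi (F : {poly 'CF(W)}) : tofrac (gX psi F) = gq psi F.
Proof. exact: (rmorph_gmult (@tofrac {poly rat})). Qed.

Let coef_coinv_poly phi n : (coinv_poly * phi%:P)`_n = C n * phi.
Proof.
rewrite coefMC; congr (_ * _); rewrite coef_sum.
have [le_nm|lt_mn] := leqP n m.
  have lt_n : (n < m.+1)%N by [].
  rewrite (bigD1 (Ordinal lt_n)) //= coefCM coefXn eqxx mulr1 big1 ?addr0 // => k.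
  by rewrite -val_eqE /= coefCM coefXn eq_sym => /negbTE->; rewrite mulr0.
rewrite big1 ?(coinv_char_big m1 hW hV) // => k _.
by rewrite coefCM coefXn gtn_eqF ?mulr0 // (leq_trans _ lt_mn) // ltn_ord.
Qed.

Lemma Kgraded_coinv phi i : phi \is a character ->
  Kgraded (fun n => C n * phi) i = gq 'chi_i (coinv_poly * phi%:P).
Proof.
move=> chphi; rewrite ffunE; apply: series_sumE.
exists (gX 'chi_i (coinv_poly * phi%:P)), 1; split.
- by rewrite coef1 oner_eq0.
- by rewrite tofrac1 divr1 tofrac_gX.
move=> n; rewrite coef_gX coef_coinv_poly -[1](expr0 'X).
rewrite (conv_Xn (fun k => (mult (C k * phi) i)%:R)) subn0.
by rewrite mult_intval // rpredM // cfRepr_char.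
Qed.

(** Degree by degree, S(V) (1 - q^2) (1 - q^m) = C.  Dividing first by 1 - q^2
    leaves the [dih n], which are periodic of period m. *)
Lemma sym_coinv n :
  S n - (if (2 <= n)%N then S (n - 2) else 0) - (if (m <= n)%N then S (n - m) else 0)
      + (if (m + 2 <= n)%N then S (n - (m + 2)) else 0) = C n.
Proof.
pose g (k : nat) : 'CF(W) := S k - (if (2 <= k)%N then S (k - 2) else 0).
have gE k : g k = dih k - (if k == 0%N then e else 0).
  rewrite /g; case: k => [|[|k]].
  - by rewrite (sym_char0 m1 hW hV) subr0 addrK.
  - by rewrite (sym_char1 m1 hW hV).
  by rewrite (sym_charSS m1 hW hV) subr0 /= !subSS subn0 addrC addKr.
transitivity (g n - (if (m <= n)%N then g (n - m)%N else 0)).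
  rewrite {1}/g; case: (leqP m n) => le_mn; last first.
    by rewrite (_ : (m + 2 <= n)%N = false) ?addr0 //; lia.
  rewrite /g opprB addrA [LHS]addrAC subnDA; congr (_ + _ - _).
  by rewrite leq_subRL // addnC.
rewrite !gE; case: n => [|n].
  by rewrite leqNgt m0 /= subr0 addrK C0.
rewrite subr0; case: (ltngtP m n.+1) => [lt_mn|lt_nm|mn].
- rewrite gtn_eqF ?subn_gt0 // subr0 (coinv_char_big m1 hW hV) //.
  by rewrite -{1}(subnK (ltnW lt_mn)) (dih_periodic m1 hW hV) subrr.
- by rewrite subr0 (coinv_dih m1 hW hV).
rewrite -mn subnn eqxx (coinv_top m1 hW hV) -{1}[m]add0n (dih_periodic m1 hW hV).
by rewrite opprB addrC subrK.
Qed.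

Definition hilbert_denom (K : comNzRingType) (x : K) := (1 - x ^+ 2) * (1 - x ^+ m).

Let denomX : hilbert_denom ('X : {poly rat}) = 1 - 'X^2 - 'X^m + 'X^(m + 2).
Proof. by rewrite /hilbert_denom exprD; ring. Qed.

Let denomq : tofrac (hilbert_denom 'X) = hilbert_denom q.
Proof. by rewrite tofracM !tofracB !tofracXn tofrac1. Qed.

Let denom0 : (hilbert_denom ('X : {poly rat}))`_0 != 0.
Proof.
rewrite denomX coefD !coefB coef1 !coefXn addn2 /= !subr0.
by rewrite (ltn_eqF m0) subr0 oner_eq0.
Qed.

Lemma Kgraded_sym phi i : phi \is a character ->
  Kgraded (fun n => S n * phi) i = gq 'chi_i (coinv_poly * phi%:P) / hilbert_denom q.
Proof.
move=> chphi; rewrite ffunE; apply: series_sumE.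
exists (gX 'chi_i (coinv_poly * phi%:P)), (hilbert_denom 'X); split => //.
  by rewrite tofrac_gX denomq.
move=> n; rewrite coef_gX coef_coinv_poly.
pose a n := (mult (S n * phi) i)%:R : rat.
have aE k : a k = intval rat '[S k * phi, 'chi_i].
  by rewrite /a mult_intval // rpredM // cfRepr_char.
rewrite denomX; under eq_bigr => k _.
  rewrite coefD !coefB -[1 in X in X - _](expr0 'X) !mulrDl !mulNr; over.
rewrite !big_split /= !sumrN !(conv_Xn a) /= subn0.
have vS k : S k * phi \in 'Z[irr W]%g by rewrite char_vchar // rpredM // cfRepr_char.
have vif (b : bool) k : (if b then S k else 0) * phi \in 'Z[irr W]%g.
  by case: b; rewrite ?vS // mul0r rpred0.
have Zif (b : bool) k : '[(if b then S k else 0) * phi, 'chi_i] \is a Num.int.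
  by rewrite Cint_cfdot_vchar_irr.
have ifE (b : bool) k :
    (if b then a k else 0) = intval rat '[(if b then S k else 0) * phi, 'chi_i].
  by case: b; rewrite ?aE // mul0r cfdot0l intval0.
have ZS : '[S n * phi, 'chi_i] \is a Num.int by rewrite Cint_cfdot_vchar_irr.
rewrite !ifE aE -!intvalB -?intvalD ?rpredB // -!cfdotBl -cfdotDl -!mulrBl -mulrDl.
by rewrite sym_coinv.
Qed.

Let mulf_cancel (F : fieldType) (a b c : F) : a != 0 -> b != 0 -> a * (b * c) / (a * b) = c.
Proof. by move=> a0 b0; field; rewrite a0 b0. Qed.

Let vch_e : e \in 'Z[irr W]%g. Proof. by rewrite char_vchar ?cfRepr_char. Qed.
Let vch_V : V \in 'Z[irr W]%g. Proof. by rewrite char_vchar ?cfRepr_char. Qed.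
Let vch_1 : 1 \in 'Z[irr W]%g. Proof. exact: rpred1. Qed.
Let ch_e : e \is a character. Proof. exact: cfRepr_char. Qed.
Let ch_V : V \is a character. Proof. exact: cfRepr_char. Qed.

Let eeP : e%:P * e%:P = 1 :> {poly 'CF(W)}.
Proof. by rewrite -polyCM (sgn_sgn m1 hW hV). Qed.

Let vM phi n : phi \in 'Z[irr W]%g -> phi%:P * 'X^n \is a polyOver 'Z[irr W]%g.
Proof. by move=> vphi; rewrite rpredM ?polyOverC ?polyOverXn. Qed.

Let q0 : q != 0. Proof. by rewrite tofrac_eq0 polyX_eq0. Qed.
Let qn0 n : q ^+ n != 0. Proof. exact: expf_neq0. Qed.

Let D := hilbert_denom q.

Let D0 : D != 0.
Proof.
rewrite /D -denomq tofrac_eq0; apply: contraNneq denom0 => ->.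
by rewrite coef0.
Qed.

Let gmultD0 psi (F : {poly 'CF(W)}) : psi \in 'Z[irr W]%g -> F \is a polyOver 'Z[irr W]%g ->
  gq psi ((1 - 'X^2) * (1 - 'X^m) * F) = D * gq psi F.
Proof.
move=> vpsi vF.
have vX (n : nat) (G : {poly 'CF(W)}) : G \is a polyOver 'Z[irr W]%g ->
    G * 'X^n \is a polyOver 'Z[irr W]%g.
  by move=> vG; rewrite rpredM ?polyOverXn.
have sub1 (n : nat) (G : {poly 'CF(W)}) : G \is a polyOver 'Z[irr W]%g ->
    gq psi (G - G * 'X^n) = gq psi G * (1 - q ^+ n).
  by move=> vG; rewrite gmultB ?vX // gmultMXn mulrBr mulr1.
have -> : (1 - 'X^2) * (1 - 'X^m) * F = (F - F * 'X^2) - (F - F * 'X^2) * 'X^m.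
  by ring.
by rewrite !sub1 ?rpredB ?vX // -mulrA mulrC.
Qed.

Variables (le : rel (Iirr W)) (hle : fake_degree_order rV le).
Variables (Q : Iirr W -> KW W) (lambda : Iirr W -> Qq).
Hypothesis hQ : lusztig_shoji rV m le Q lambda.

Let Kdot_class (u : KW W) phi : phi \is a character ->
  Kdot u (Kclass phi) = \sum_j u j * intval Qq '[phi, 'chi_j].
Proof. by move=> chphi; apply: eq_bigr => j _; rewrite ffunE mult_intval. Qed.

Let Kdot_irr (u : KW W) j : Kdot u (Kclass 'chi_j) = u j.
Proof.
rewrite Kdot_class ?irr_char // (bigD1 j) //= cfnorm_irr (intval_nat _ 1) mulr1.
rewrite big1 ?addr0 // => k kj.
by rewrite cfdot_irr eq_sym (negbTE kj) intval0 mulr0.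
Qed.

Let Omega j k := q ^+ m * gq 'chi_k (coinv_poly * ('chi_j * e)%:P).

Let OmegaE j k : Omega j k = \sum_l lambda l * Q l j * Q l k.
Proof.
have [_ _ _ eqQ] := hQ; have := eqQ j k; rewrite Kdot_irr.
under [RHS]eq_bigr do rewrite !Kdot_irr.
move=> <-; rewrite /Omega -Kgraded_coinv ?rpredM ?irr_char //.
by congr (_ * Kgraded _ _); apply: boolp.funext => n; rewrite mulrA.
Qed.

Let Q_le i j : ~~ le i j -> Q i j = 0.
Proof. by have [_ _ Q_tri _] := hQ; move/Q_tri; rewrite Kdot_irr. Qed.

Let Qii i : Q i i = q ^+ fdeg i.
Proof. by have [_ Q_diag _ _] := hQ; rewrite -Q_diag Kdot_irr. Qed.

Let le_fdeg i j : j = i \/ (fdeg i < fdeg j)%N -> le j i.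
Proof.
have [le_refl _ _ le_tot le_b] := hle => -[-> //|lt_b].
by have := le_tot j i => /orP[//|/le_b]; rewrite leqNgt lt_b.
Qed.

(** Pairing with the matrix Omega is tensoring with q^m C sgn. *)
Let Omega_sum (F : {poly 'CF(W)}) k : F \is a polyOver 'Z[irr W]%g ->
  \sum_j gq 'chi_j F * Omega j k = q ^+ m * gq 'chi_k (coinv_poly * e%:P * F).
Proof.
move=> vF; rewrite -(gmult_mul _ (irr_vchar k) vF); last first.
  by rewrite rpredM ?polyOverC ?coinv_poly_vchar.
rewrite mulr_sumr; apply: eq_bigr => j _; rewrite /Omega mulrCA; congr (_ * (_ * gq _ _)).
by rewrite polyCM -mulrA [e%:P * _]mulrC.
Qed.

Let dual_green_vchar i : dual_green i \is a polyOver 'Z[irr W]%g.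
Proof. by rewrite rpredM ?polyOverC // rpredM ?koszul_poly_vchar ?green_vchar. Qed.

(** [green i] is the image of [dual_green i] / (q^m D) under Omega, since sgn^2 = 1
    and the Koszul complex inverts C up to D. *)
Lemma green_unique i : (forall k, Q i k = gq 'chi_k (green i)) /\
  lambda i * (q ^+ fdeg i * (gq 'chi_i (dual_green i) / (q ^+ m * D))) = 1.
Proof.
have [le_refl le_anti le_trans _ _] := hle.
apply: (triangular_unique le_refl le_anti le_trans Q_le Qii (fun i => qn0 (fdeg i))
  (Omega := Omega) (p := fun k => gq 'chi_k (green i))
  (y := fun j => gq 'chi_j (dual_green i) / (q ^+ m * D))) => //.
- move=> k; under eq_bigr => j _ do rewrite mulrAC.
  rewrite -mulr_suml Omega_sum //.
  have -> : coinv_poly * e%:P * dual_green i = (1 - 'X^2) * (1 - 'X^m) * green i.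
    rewrite -(koszul_coinv m1 hW hV) -[RHS]mul1r -eeP.
    rewrite /dual_green; move: coinv_poly koszul_poly (green i) e%:P => A B G E; ring.
  rewrite gmultD0 ?irr_vchar ?green_vchar //.
  exact: (mulf_cancel _ (qn0 m) D0).
- move=> j; rewrite mulf_eq0 negb_or => /andP[nz _]; apply: le_fdeg.
  exact: (dual_green_support m1 hW hV) nz.
- move=> j /(green_support m1 hW hV)[->|lt_b]; apply: le_fdeg; first by left.
  by right.
exact: (green_diag m1 hW hV).
Qed.

Let koszul_terms (R : comNzRingType) (a b c s : R) :
  a + ((- s) ^+ 1 * b + (- s) ^+ 2 * c) = a - b * s + c * s ^+ 2.
Proof. ring. Qed.

Let omega_terms (R : comNzRingType) (a b c d : R) : a * (b * c * d) = b * (a * c) * d.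
Proof. ring. Qed.

Let kappa_terms (F : fieldType) (l p y n : F) : n != 0 -> n * (l * p / n * y) = l * p * y.
Proof. by move=> n0; field. Qed.

Let krew_terms (F : fieldType) (l p n d g : F) : l * (d * (g / n)) = 1 ->
  l * p / n * (d * g) = p.
Proof.
by move=> h; rewrite -[RHS]mul1r -h; ring.
Qed.

Let Zdot phi j : phi \in 'Z[irr W]%g -> '['chi_j, phi] = '[phi, 'chi_j].
Proof.
move=> vphi; rewrite cfdotC conj_intr //.
by rewrite Cint_cfdot_vchar_irr.
Qed.

Let green_dot phi i : phi \in 'Z[irr W]%g ->
  \sum_j Q i j * intval Qq '[phi, 'chi_j] = gq phi (green i).
Proof.
move=> vphi; have [QE _] := green_unique i.
rewrite -[green i in RHS]mul1r -gmult_mul ?rpred1 ?green_vchar //.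
by apply: eq_bigr => j _; rewrite QE mul1r gmultC Zdot.
Qed.

Lemma Q_dot_V i : Kdot (Q i) (Kclass V) = gq V (green i).
Proof. by rewrite Kdot_class // (green_dot _ vch_V). Qed.

Variable t : nat.

(** Tensored with sgn, this is 1 - q^t V + q^(2t) sgn. *)
Let twist : {poly 'CF(W)} := e%:P - V%:P * 'X^t + 1%:P * 'X^(t.*2).

Let twist_vchar : twist \is a polyOver 'Z[irr W]%g.
Proof. by rewrite rpredD ?vM // rpredB ?vM // polyOverC. Qed.

Let sum3 (R : comNzRingType) (I : finType) (w a b c : I -> R) s u :
  \sum_j (a j - b j * s + c j * u) * w j
    = \sum_j w j * a j - s * \sum_j w j * b j + u * \sum_j w j * c j.
Proof.
rewrite !mulr_sumr -sumrB -big_split /=; apply: eq_bigr => j _; ring.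
Qed.

Let twist_dot l : \sum_j gq 'chi_j twist * Q l j = green_pairing rV q t l.
Proof.
rewrite /green_pairing -!green_dot // -sum3; apply: eq_bigr => j _; congr (_ * _).
rewrite gmultD ?irr_vchar ?vM ?rpredB ?polyOverC ?vM // gmultB ?irr_vchar ?polyOverC ?vM //.
by rewrite !gmultMXn !gmultC.
Qed.

Let Koszul_coord k : D * Koszul rV t k = gq 'chi_k (coinv_poly * e%:P * twist).
Proof.
have KE phi : phi \is a character ->
    D * Kgraded (fun n => S n * phi) k = gq 'chi_k (coinv_poly * phi%:P).
  by move=> chphi; rewrite Kgraded_sym // mulrC divfK.
have -> : Koszul rV t k = \sum_(i < 3) (- q ^+ t) ^+ i * Kgraded (fun n => S n * ext_char rV i) k.
  by rewrite sum_ffunE; apply: eq_bigr => i _; rewrite ffunE.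
rewrite mulr_sumr; under eq_bigr => i _ do rewrite mulrCA.
rewrite !big_ord_recl big_ord0 addr0 !KE ?rpred1 //= !expr0 mul1r.
have -> : coinv_poly * e%:P * twist =
    coinv_poly * 1%:P - coinv_poly * V%:P * 'X^t + coinv_poly * e%:P * 'X^(t.*2).
  have evP : e%:P * V%:P = V%:P :> {poly 'CF(W)} by rewrite -polyCM (sgn_V m1 hW hV).
  rewrite /twist polyC1 mulr1 mul1r mulrDr mulrBr -!mulrA eeP (mulrA e%:P) evP mulr1.
  by [].
rewrite gmultD ?irr_vchar ?gmultB ?irr_vchar ?gmultMXn //; last first.
- by rewrite rpredM ?polyOverXn // rpredM ?coinv_poly_vchar ?polyOverC.
- by rewrite rpredB ?rpredM ?polyOverXn ?coinv_poly_vchar ?polyOverC.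
- by rewrite rpredM ?polyOverXn // rpredM ?coinv_poly_vchar ?polyOverC.
- by rewrite rpredM ?coinv_poly_vchar ?polyOverC.
rewrite -muln2 exprM; exact: koszul_terms.
Qed.

Let kappa l := lambda l * green_pairing rV q t l / (q ^+ m * D).

Let Koszul_green : Koszul rV t = \sum_l kappa l *: Q l.
Proof.
apply/ffunP => k; rewrite [RHS]sum_ffunE; under [RHS]eq_bigr do rewrite ffunE.
apply: (mulfI (mulf_neq0 (qn0 m) D0)).
transitivity (q ^+ m * gq 'chi_k (coinv_poly * e%:P * twist)).
  by rewrite -mulrA Koszul_coord.
rewrite -Omega_sum // mulr_sumr.
transitivity (\sum_l lambda l * (\sum_j gq 'chi_j twist * Q l j) * Q l k).
  under eq_bigr => j _ do rewrite OmegaE mulr_sumr.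
  rewrite exchange_big; apply: eq_bigr => l _ /=.
  rewrite mulr_sumr mulr_suml; apply: eq_bigr => j _; exact: omega_terms.
apply: eq_bigr => l _; rewrite twist_dot.
exact: esym (kappa_terms _ _ _ (mulf_neq0 (qn0 m) D0)).
Qed.

Let Q_free : free [tuple Q j | j < Nirr W].
Proof.
have [le_refl le_anti le_trans _ _] := hle.
apply/freeP => k k0; apply: (triangular_free le_refl le_anti le_trans Q_le Qii
  (fun i => qn0 (fdeg i))) => j.
transitivity ((\sum_(i < Nirr W) k i *: [tuple Q j | j < Nirr W]`_i) j); last by rewrite k0 ffunE.
rewrite sum_ffunE.
by apply: eq_bigr => i _; rewrite ffunE nth_mktuple.
Qed.

(** As Omega y = sum_l lambda_l <Q_l, y> Q_l, the coefficients of the Koszul class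
    are the numbers [kappa l]; the value of lambda_i comes from [green_unique]. *)
Lemma Krew_green i :
  Krew rV Q t i * (q ^+ fdeg i * gq 'chi_i (dual_green i)) = green_pairing rV q t i.
Proof.
have -> : Krew rV Q t i = kappa i.
  rewrite /Krew Koszul_green -(coord_sum_free kappa i Q_free); congr (coord _ _ _).
  by apply: eq_bigr => l _; rewrite nth_mktuple.
have [_ lambdaE] := green_unique i.
exact: krew_terms lambdaE.
Qed.

End LusztigShoji.

(** * Closed forms *)

Section ClosedForms.

Variables (F : fieldType) (x : F).
Hypotheses (x0 : x != 0) (xn : forall n, (0 < n)%N -> x ^+ n != 1).

Let bracket (k : int) : F := (x ^ k - 1) / (x - 1).

Let expzB (a b : nat) : x ^ (a%:Z - b%:Z) = x ^+ a / x ^+ b.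
Proof. by rewrite expfzDr // -invr_expz. Qed.

Let xn0 n : x ^+ n != 0. Proof. exact: expf_neq0. Qed.

Let sub1 n : (0 < n)%N -> x ^+ n - 1 != 0.
Proof. by move=> n0; rewrite subr_eq0 xn. Qed.

Let x1 : x - 1 != 0. Proof. by rewrite -(expr1 x) sub1. Qed.

Let solve (K d p : F) : d != 0 -> K * d = p -> K = p / d.
Proof. by move=> d0 <-; rewrite mulfK. Qed.

Lemma krew_triv t K : K * (x ^+ 0 * x ^+ 2) = x ^+ t.*2 -> K = x ^ (2 * t%:Z - 2).
Proof.
move/solve => ->; rewrite ?mulf_neq0 //.
by rewrite -PoszM (expzB (2 * t) 2) mul2n expr0 mul1r.
Qed.

Lemma krew_sgn t m K : (1 < m)%N ->
    K * (x ^+ m * (1 - x ^+ 2 - x ^+ m + x ^+ m.+2))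
      = x ^+ m - x ^+ t * (x ^+ m.-1 + x) + x ^+ t.*2 ->
  K = bracket (t%:Z - 1) * bracket (t%:Z - m%:Z + 1) / (bracket 2 * bracket m%:Z).
Proof.
move=> m1; have m0 : (0 < m)%N := ltnW m1.
have eM1 : x ^+ m.-1 = x ^+ m / x by rewrite -{2}(prednK m0) exprSr mulfK.
have eM2 : x ^+ m.+2 = x ^+ m * x ^+ 2 by rewrite -exprD addn2.
have e1 : x ^ (t%:Z - 1) = x ^+ t / x by rewrite (expzB t 1) expr1.
have e2 : x ^ (t%:Z - m%:Z + 1) = x ^+ t * x / x ^+ m.
  by rewrite addrAC -PoszD expzB addn1 exprSr.
rewrite eM1 eM2 -muln2 exprM /bracket e1 e2 -!exprnP.
have := sub1 m0; have := xn0 m; have := sub1 (isT : 0 < 2)%N.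
move: (x ^+ m) (x ^+ t) => M T s2 M0 sM.
have -> : 1 - x ^+ 2 - M + M * x ^+ 2 = (x ^+ 2 - 1) * (M - 1) by ring.
by move/solve => ->; [field; rewrite x0 M0 s2 sM x1 | rewrite !mulf_neq0].
Qed.

Lemma krew_mid t b K : K * (x ^+ b * (x ^+ b.+2 - 0 * x ^+ b.+1)) = x ^+ t.*2 - x ^+ t.+1 ->
  K = x ^ (t%:Z - 2 * b%:Z - 1) * (x ^ (t%:Z - 1) - 1).
Proof.
rewrite mul0r subr0 => /solve ->; last by rewrite mulf_neq0.
have -> : t%:Z - 2 * b%:Z - 1 = t%:Z - (2 * b + 1)%N%:Z :> int by lia.
rewrite !expzB expr1 -muln2 exprM addn1 mul2n -addnn !exprS exprD.
have := xn0 b; move: (x ^+ b) (x ^+ t) => B T B0; field; by rewrite x0 B0.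
Qed.

Lemma krew_mid_top t b m K : b.*2.+1 = m ->
    K * (x ^+ b * (x ^+ b.+2 - 1 * x ^+ b.+1)) = x ^+ t.*2 - x ^+ t.+1 ->
  K = x ^ (t%:Z - m%:Z + 1) * bracket (t%:Z - 1).
Proof.
move=> <-; have -> : t%:Z - b.*2.+1%:Z + 1 = t%:Z - (b.*2)%:Z :> int by lia.
rewrite /bracket expzB (expzB t 1) -!muln2 !exprM !exprS.
have := xn0 b; move: (x ^+ b) (x ^+ t) => B T B0.
have -> : x * (x * B) - 1 * (x * B) = x * B * (x - 1) by ring.
by move/solve => ->; [field; rewrite x0 B0 x1 | rewrite !mulf_neq0].
Qed.

Lemma krew_half t b m K : b.*2 = m ->
    K * (x ^+ b * (x ^+ b.+2 - x ^+ b)) = x ^+ t.*2 - x ^+ t.+1 ->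
  K = x ^ (t%:Z - m%:Z + 1) * bracket (t%:Z - 1) / bracket 2.
Proof.
move=> <-; have -> : t%:Z - b.*2%:Z + 1 = t.+1%:Z - (b.*2)%:Z :> int by lia.
rewrite /bracket expzB (expzB t 1) -exprnP -!muln2 !exprM !exprS !expr0 !mulr1.
have := sub1 (isT : 0 < 2)%N; rewrite expr2.
have := xn0 b; move: (x ^+ b) (x ^+ t) => B T B0 s2.
have -> : x * (x * B) - B = B * (x * x - 1) by ring.
by move/solve => ->; [field; rewrite x0 B0 x1 s2 | rewrite !mulf_neq0].
Qed.

End ClosedForms.

Theorem mainTheorem7 (m : nat) (hm : (2 <= m)%N)
    (gT : finGroupType) (W : {group gT}) (s0 s1 : gT)
    (hW : I2_system m W s0 s1)
    (rV : mx_representation algC W 2) (hV : is_reflection_repr m s0 s1 rV)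
    (le : rel (Iirr W)) (hle : fake_degree_order rV le)
    (Q : Iirr W -> KW W) (lambda : Iirr W -> Qq)
    (hQ : lusztig_shoji rV m le Q lambda)
    (t : nat) (ht : (0 < t)%N) :
  let QV (i : Iirr W) : Qq := Kdot (Q i) (Kclass (cfRepr rV)) in
  (~~ odd m ->
    [/\ forall i : Iirr W, is_phi rV 1 0 i ->
          Krew rV Q t i = q ^ (2 * t%:Z - 2) /\ QV i = 0,
        forall i : Iirr W, is_phi rV 1 m./2 i ->
          Krew rV Q t i = q ^ (t%:Z - m%:Z + 1) * qint (t%:Z - 1) / qint 2
          /\ QV i = q,
        forall i : Iirr W, is_phi rV 1 m i ->
          Krew rV Q t i
            = qint (t%:Z - 1) * qint (t%:Z - m%:Z + 1) / (qint 2 * qint m%:Z)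
          /\ QV i = q ^ (m%:Z - 1) + q
      & forall (r : nat) (i : Iirr W), (1 <= r <= m./2 - 1)%N ->
          is_phi rV 2 r i ->
          Krew rV Q t i = q ^ (t%:Z - 2 * r%:Z - 1) * (q ^ (t%:Z - 1) - 1)
          /\ QV i = q])
  /\
  (odd m ->
    [/\ forall i : Iirr W, is_phi rV 1 0 i ->
          Krew rV Q t i = q ^ (2 * t%:Z - 2) /\ QV i = 0,
        forall i : Iirr W, is_phi rV 1 m i ->
          Krew rV Q t i
            = qint (t%:Z - 1) * qint (t%:Z - m%:Z + 1) / (qint 2 * qint m%:Z)
          /\ QV i = q ^ (m%:Z - 1) + q,
        forall (r : nat) (i : Iirr W), (1 <= r <= (m - 3)./2)%N ->
          is_phi rV 2 r i ->
          Krew rV Q t i = q ^ (t%:Z - 2 * r%:Z - 1) * (q ^ (t%:Z - 1) - 1)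
          /\ QV i = q
      & forall i : Iirr W, is_phi rV 2 (m - 1)./2 i ->
          Krew rV Q t i = q ^ (t%:Z - m%:Z + 1) * qint (t%:Z - 1)
          /\ QV i = q]).
Proof.
move=> QV; have m0 : (0 < m)%N := ltnW hm.
have q0 : q != 0 by rewrite tofrac_eq0 polyX_eq0.
have qn n : (0 < n)%N -> q ^+ n != 1.
  move=> n0; rewrite -tofracXn -tofrac1 tofrac_eq; apply/eqP.
  move=> /(congr1 (fun p : {poly rat} => p`_n)).
  by move/eqP; rewrite coefXn eqxx coef1 gtn_eqF // oner_eq0.
have qm1 : q ^ (m%:Z - 1) = q ^+ m.-1 by rewrite -[in LHS](prednK m0) -addn1 PoszD addrK.
have QVE i : QV i = gmult q (cfRepr rV) (green rV i) := Q_dot_V hm hW hV hle hQ i.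
have KE i := Krew_green hm hW hV hle hQ t i.
have cases i := green_values hm hW hV q t i.
have triv i : is_phi rV 1 0 i -> Krew rV Q t i = q ^ (2 * t%:Z - 2) /\ QV i = 0.
  case=> _ b0; have := KE i; rewrite QVE; case: (cases i); rewrite b0.
  - by case=> _ -> -> -> /(krew_triv q0).
  - by case=> mE; move: m0; rewrite -mE.
  - by case=> -[].
  by case=> mE; move: m0; rewrite -mE.
have sgn i : is_phi rV 1 m i -> Krew rV Q t i
      = qint (t%:Z - 1) * qint (t%:Z - m%:Z + 1) / (qint 2 * qint m%:Z)
    /\ QV i = q ^ (m%:Z - 1) + q.
  case=> _ bm; have := KE i; rewrite QVE qm1; case: (cases i); rewrite bm.
  - by case=> mE; move: m0; rewrite mE.
  - by case=> _ -> -> -> /(krew_sgn q0 qn hm).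
  - by case=> -[_]; rewrite -addnn; lia.
  by case; rewrite -addnn; lia.
have mid r i : (0 < r)%N -> (r.*2.+1 < m)%N -> is_phi rV 2 r i ->
    Krew rV Q t i = q ^ (t%:Z - 2 * r%:Z - 1) * (q ^ (t%:Z - 1) - 1) /\ QV i = q.
  move=> r0 lt_rm [_ br]; have := KE i; rewrite QVE; case: (cases i); rewrite br.
  - by case=> rE; move: r0; rewrite rE.
  - by case=> rE; lia.
  - by case=> _ -> -> ->; rewrite (ltn_eqF lt_rm) mulr0n => /(krew_mid q0 qn).
  by case; lia.
split=> [even_m|odd_m]; split=> //.
- move=> i [_ bE]; have m2 : m = m./2.*2.
    by rewrite -[LHS]odd_double_half (negbTE even_m).
  have h0 : (0 < m./2)%N by rewrite half_gt0.
  have := KE i; rewrite QVE; case: (cases i); rewrite bE.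
  + by case=> rE; move: h0; rewrite rE.
  + by case; lia.
  + by case=> -[_]; lia.
  by case=> bm -> -> -> /(krew_half q0 qn bm).
- move=> r i /andP[r0 le_r]; apply: mid => //.
  by lia.
- move=> r i /andP[r0 le_r]; apply: mid => //.
  by lia.
move=> i [_ bE]; have m2 : (m - 1)./2.*2.+1 = m.
  by rewrite subn1 -[in RHS](odd_double_half m) odd_m; lia.
have := KE i; rewrite QVE; case: (cases i); rewrite bE.
- by case; lia.
- by case; lia.
- by case=> _ -> -> ->; rewrite m2 eqxx mulr1n => /(krew_mid_top q0 qn m2).
by case; lia.
Qed.
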